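(* Let $R=\bigoplus_{n\in\mathbb{N}_0}R_n$ be a standard graded Noetherian ring whose base ring $(R_0,\mathfrak{m}_0)$ is local, and let $i\in\mathbb{N}_0$. Let $\mathfrak{b}:=\mathfrak{b}_0R+R_+$, where $\mathfrak{b}_0$ is an ideal of $R_0$, and suppose that for every finitely generated graded $R$-module $M$ one has $$\bigcap_{k=0}^{\infty}\mathfrak{m}_0^{k}\,H^{i}_{\mathfrak{b},\mathfrak{m}_0R}(M)_n=0\quad\text{for all } n\gg 0 .$$ Then for every finitely generated graded $R$-module $M$ one has $H^{i}_{\mathfrak{b},\mathfrak{m}_0R}(M)_n=0$ for all $n\gg 0$.
   Context: All rings are commutative Noetherian with identity. ''Standard graded'' means that $R=\bigoplus_{n\in\mathbb{N}_0}R_n$ is generated as an $R_0$-algebra by finitely many elements of $R_1$; $R_+:=\bigoplus_{n\geq 1}R_n$. For ideals $I,J$ of $R$ and an $R$-module $M$, the $(I,J)$-torsion submodule is $\Gamma_{I,J}(M):=\{x\in M: I^nx\subseteq Jx \text{ for } n\gg 1\}$ (equivalently, $I^n\subseteq \mathrm{Ann}(x)+J$ for some $n$), and $H^i_{I,J}(-)$ is the $i$-th right derived functor of $\Gamma_{I,J}(-)$. If $I,J$ are homogeneous and $M$ is graded, then $H^i_{I,J}(M)$ is a graded $R$-module: take a resolution of $M$ by injective objects in the category of graded $R$-modules and homogeneous (degree $0$) homomorphisms, apply $\Gamma_{I,J}$ and take cohomology. $H^i_{I,J}(M)_n$ denotes the component of degree $n$, an $R_0$-module. ''For all $n\gg0$''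 means for all sufficiently large integers $n$ (the bound may depend on $M$). *)

(* Defs.v *)
From HB Require Import structures.
From mathcomp Require Import all_boot all_order all_algebra.
From mathcomp Require Import boolp classical_sets.

Set Implicit Arguments.
Unset Strict Implicit.
Unset Printing Implicit Defensive.

Import GRing.Theory.
Local Open Scope ring_scope.
Local Open Scope quotient_scope.
Local Open Scope classical_set_scope.

(* S A = finite sums of products c a with c in S and a in A.  According to the
   arguments, this is an S-submodule generated by A, a product of ideals, the
   extension of an ideal, or a submodule I N. *)
Definition lspan (R : comNzRingType) (V : lmodType R) (S : set R) (A : set V) :
    set V :=
  [set x | exists p (c : 'I_p -> R) (a : 'I_p -> V),
     [/\ forall k, S (c k), forall k, A (a k) & x = \sum_(k < p) c k *: a k]].

(* Ideals of a subring S of R; the base ring R_0 is a subset of R.  The ideals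
   of R itself are those of S = setT. *)
Definition ideal_of (R : comNzRingType) (S I : set R) : Prop :=
  [/\ I `<=` S, I 0, forall a b, I a -> I b -> I (a + b)
    & forall c a, S c -> I a -> I (c * a)].

Definition ideal_pow (R : comNzRingType) (S I : set R) (n : nat) : set R :=
  lspan S ([set a | exists2 f : 'I_n -> R,
             forall k, I (f k) & a = \prod_(k < n) f k] : set R^o).

Definition ideal_add (R : comNzRingType) (I J : set R) : set R :=
  [set x | exists a b, [/\ I a, J b & x = a + b]].

Definition ideal_ext (R : comNzRingType) (I : set R) : set R :=
  lspan I [set: R^o].

Definition noetherian (R : comNzRingType) : Prop :=
  forall I : set R, ideal_of setT I ->
    exists s : seq R, I = lspan setT ([set` s] : set R^o).

Definition maximal_ideal (R : comNzRingType) (S m : set R) : Prop :=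
  [/\ ideal_of S m, m <> S
    & forall I, ideal_of S I -> m `<=` I -> I = m \/ I = S].

Definition local_ring (R : comNzRingType) (S m : set R) : Prop :=
  maximal_ideal S m /\ (forall m', maximal_ideal S m' -> m' = m).

Definition direct_sum_decomposition (T : eqType) (V : zmodType)
    (G : T -> set V) : Prop :=
  [/\ forall t, G t 0 /\ (forall x y, G t x -> G t y -> G t (x - y)),
      forall x, exists (s : seq T) (f : T -> V),
        (forall t, G t (f t)) /\ x = \sum_(t <- s) f t
    & forall (s : seq T) (f : T -> V), uniq s -> (forall t, G t (f t)) ->
        \sum_(t <- s) f t = 0 -> forall t, t \in s -> f t = 0].

Definition ring_grading (R : comNzRingType) (Rg : nat -> set R) : Prop :=
  [/\ direct_sum_decomposition Rg, Rg 0%N 1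
    & forall i j a b, Rg i a -> Rg j b -> Rg (i + j)%N (a * b)].

Definition standard_graded (R : comNzRingType) (Rg : nat -> set R) : Prop :=
  ring_grading Rg /\
  exists s : seq R, [set` s] `<=` Rg 1%N /\
    forall A : set R, subring_closed (mem A) ->
      Rg 0%N `<=` A -> [set` s] `<=` A -> A = setT.

Definition irrelevant_ideal (R : comNzRingType) (Rg : nat -> set R) : set R :=
  [set x | exists p (f : nat -> R),
     (forall k, Rg k.+1 (f k)) /\ x = \sum_(k < p) f k].

Record grmod (R : comNzRingType) (Rg : nat -> set R) := GrMod {
  grmod_sort :> lmodType R;
  grc : int -> set grmod_sort;
  grc_sum : direct_sum_decomposition grc;
  grc_scale : forall (i : nat) (n : int) a x,
    Rg i a -> grc n x -> grc (i%:Z + n) (a *: x) }.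

Section GradedModules.
Variables (R : comNzRingType) (Rg : nat -> set R).

Definition fin_gen (M : grmod Rg) : Prop :=
  exists s : seq M, lspan setT [set` s] = [set: M].

Definition homogeneous_map (M N : grmod Rg) (f : M -> N) : Prop :=
  forall n x, grc n x -> grc n (f x).

(* Injective objects of the category of graded modules and homogeneous maps of
   degree 0, whose monomorphisms are the injective ones. *)
Definition gr_injective (E : grmod Rg) : Prop :=
  forall (A B : grmod Rg) (u : {linear A -> B}) (f : {linear A -> E}),
    homogeneous_map u -> homogeneous_map f -> injective u ->
    exists2 g : {linear B -> E}, homogeneous_map g & forall x, g (u x) = f x.

Record gr_inj_resolution (M : grmod Rg) := GrInjResolution {
  res :> nat -> grmod Rg;
  res_d : forall k, {linear res k -> res k.+1};
  res_aug : {linear M -> res 0%N};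
  res_inj : forall k, gr_injective (res k);
  res_d_homog : forall k, homogeneous_map (res_d k);
  res_aug_homog : homogeneous_map res_aug;
  res_aug_inj : injective res_aug;
  res_exact0 : range res_aug = [set x | res_d 0%N x = 0];
  res_exactS : forall k, range (res_d k) = [set x | res_d k.+1 x = 0] }.

End GradedModules.

Definition torsion (R : comNzRingType) (I J : set R) (V : lmodType R) : set V :=
  [set x | exists n0, forall n, (n0 <= n)%N -> forall a, ideal_pow setT I n a ->
     exists2 b, J b & a *: x = b *: x].

Arguments torsion {R} I J V.

Lemma torsion_submod (R : comNzRingType) (I J : set R) (V : lmodType R) :
  ideal_of setT J -> submod_closed (mem (torsion I J V)).
Proof.
case=> _ J0 JD JM.
have JB a b : J a -> J b -> J (a - b).
  by move=> Ja Jb; rewrite -(mulN1r b); apply: JD => //; apply: JM.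
split=> [|c x y /set_mem[n1 Hx] /set_mem[n2 Hy]]; apply/mem_set.
  by exists 0%N => n _ a _; exists 0 => //; rewrite !scaler0.
exists (n1 + n2)%N => n le_n a [p [e [u [_ Iu ->]]]].
suff /choice[g gP] : forall k, exists b,
    J b /\ u k *: (c *: x + y) = b *: (c *: x + y).
  exists (\sum_(k < p) e k * g k).
    elim/big_rec: _ => [//|k z _ Jz]; apply: JD (Jz).
    by apply: JM => //; case: (gP k).
  rewrite !scaler_suml; apply: eq_bigr => k _.
  by rewrite -!scalerA; case: (gP k) => _ ->.
move=> k; have [f If ->] := Iu k.
have le1 : (n1 <= n)%N := leq_trans (leq_addr _ _) le_n.
have I_prod m (h : 'I_m -> R) : (forall j, I (h j)) ->
    ideal_pow setT I m (\prod_(j < m) h j).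
  move=> Ih; exists 1%N, (fun=> 1), (fun=> \prod_(j < m) h j).
  by split=> // [_|]; [exists h|rewrite big_ord1 scale1r].
have nE : (n1 + (n - n1))%N = n by rewrite subnKC.
have -> : \prod_(j < n) f j = (\prod_(j < n1) f (cast_ord nE (lshift _ j)))
    * (\prod_(j < n - n1) f (cast_ord nE (rshift _ j))).
  rewrite (reindex (cast_ord nE)) ?big_split_ord //=.
  by exists (cast_ord (esym nE)) => j _; rewrite ?cast_ordK ?cast_ordKV.
set s := \prod_(j < n1) _; set t := \prod_(j < n - n1) _.
have [b Jb sx] : exists2 b, J b & s *: x = b *: x.
  by apply: (Hx n1) => //; apply: I_prod.
have [b' Jb' ty] : exists2 b, J b & t *: y = b *: y.
  by apply: (Hy (n - n1)%N); [rewrite leq_subRL|apply: I_prod].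
exists (s * b' + t * b - b * b'); split.
  by apply: JB; [apply: JD|]; apply: JM.
have kx : (s - b) *: x = 0 by rewrite scalerBl sx subrr.
have ky : (t - b') *: y = 0 by rewrite scalerBl ty subrr.
apply/eqP; rewrite -subr_eq0 -scalerBl.
have -> : s * t - (s * b' + t * b - b * b') = (s - b) * (t - b').
  by rewrite mulrBl !mulrBr (mulrC t b) !opprD !opprK !addrA.
rewrite scalerDr -[in X in _ + X]scalerA ky scaler0 addr0.
by rewrite (mulrC (s - b)) scalerA -mulrA (mulrC _ c) mulrA -scalerA kx scaler0.
Qed.

Lemma lspan_submod (R : comNzRingType) (V : lmodType R) (A : set V) :
  submod_closed (mem A) -> lspan setT A = A.
Proof.
case=> A0 Alin; apply/seteqP; split=> x.
  move=> [p [c [a [_ Aa ->]]]]; apply/set_mem.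
  elim/big_rec: _ => [//|k y _ Ay]; apply: (Alin) => //.
  exact/mem_set.
move=> Ax; exists 1%N, (fun=> 1), (fun=> x).
by split=> //; rewrite big_ord1 scale1r.
Qed.

Section ModuleQuotient.
Variables (R : comNzRingType) (V : lmodType R) (A : set V).

Definition in_lspan : {pred V} := fun x => x \in lspan setT A.

Lemma in_lspan_submod : submod_closed in_lspan.
Proof.
split=> [|a x y].
  apply/mem_set; exists 0%N, (fun=> 0), (fun=> 0).
  by split=> [[]//|[]//|]; rewrite big_ord0.
move=> /set_mem [p [c [u [_ uA ->]]]] /set_mem [q [e [v [_ vA ->]]]].
apply/mem_set; exists (p + q)%N.
exists (fun k => match split k with inl i => a * c i | inr j => e j end).
exists (fun k => match split k with inl i => u i | inr j => v j end).
split=> // [k|]; first by case: (split k).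
rewrite big_split_ord /= scaler_sumr; congr (_ + _); apply: eq_bigr => k _.
  by rewrite (unsplitK (inl k)) scalerA.
by rewrite (unsplitK (inr k)).
Qed.

HB.instance Definition _ := GRing.isSubmodClosed.Build R V in_lspan
  in_lspan_submod.

(* The quotient of V by the submodule generated by A. *)
Definition quotmod : Type := Quotient.quot (in_lspan : zmodClosed V).

HB.instance Definition _ := GRing.Zmodule.on quotmod.

Definition quotmod_pi (x : V) : quotmod :=
  \pi_(Quotient.quot (in_lspan : zmodClosed V)) x.

Definition quotmod_scale (a : R) (q : quotmod) : quotmod :=
  quotmod_pi (a *: repr (q : Quotient.quot (in_lspan : zmodClosed V))).

Lemma quotmod_piD : {morph quotmod_pi : x y / x + y}.
Proof. by move=> x y; rewrite /quotmod_pi piE. Qed.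

Lemma quotmod_piZ a x : quotmod_pi (a *: x) = quotmod_scale a (quotmod_pi x).
Proof.
apply/eqP; rewrite /quotmod_scale /quotmod_pi -Quotient.idealrBE -scalerBr.
by rewrite rpredZ // Quotient.idealrBE reprK.
Qed.

Lemma quotmod_ind (P : quotmod -> Prop) :
  (forall x, P (quotmod_pi x)) -> forall q, P q.
Proof.
move=> Ppi q.
by have := Ppi (repr (q : Quotient.quot (in_lspan : zmodClosed V)));
   rewrite /quotmod_pi reprK.
Qed.

Fact quotmod_scaleA a b q :
  quotmod_scale a (quotmod_scale b q) = quotmod_scale (a * b) q.
Proof. by elim/quotmod_ind: q => x; rewrite -!quotmod_piZ scalerA. Qed.

Fact quotmod_scale1 : left_id 1 quotmod_scale.
Proof. by elim/quotmod_ind=> x; rewrite -quotmod_piZ scale1r. Qed.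

Fact quotmod_scaleDr : right_distributive quotmod_scale +%R.
Proof.
move=> a; elim/quotmod_ind=> x; elim/quotmod_ind=> y.
by rewrite -quotmod_piD -!quotmod_piZ -quotmod_piD scalerDr.
Qed.

Fact quotmod_scaleDl q : {morph quotmod_scale^~ q : a b / a + b}.
Proof.
move=> a b; elim/quotmod_ind: q => x.
by rewrite -!quotmod_piZ -quotmod_piD scalerDl.
Qed.

HB.instance Definition _ := GRing.Zmodule_isLmodule.Build R quotmod
  quotmod_scaleA quotmod_scale1 quotmod_scaleDr quotmod_scaleDl.

Fact quotmod_pi_zmod_morphism : zmod_morphism quotmod_pi.
Proof.
by move=> x y; apply/eqP; rewrite eq_sym subr_eq -quotmod_piD subrK.
Qed.

HB.instance Definition _ := GRing.isZmodMorphism.Build V quotmod quotmod_pi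
  quotmod_pi_zmod_morphism.

HB.instance Definition _ := GRing.isScalable.Build R V quotmod *:%R quotmod_pi
  quotmod_piZ.

Lemma quotmod_pi_eq0 x : quotmod_pi x = 0 <-> lspan setT A x.
Proof.
rewrite -(raddf0 quotmod_pi); split=> [/eqP|Ax]; last apply/eqP.
  by rewrite /quotmod_pi -Quotient.idealrBE subr0 => /set_mem.
by rewrite /quotmod_pi -Quotient.idealrBE subr0; apply/mem_set.
Qed.

End ModuleQuotient.

Section LocalCohomology.
Variables (R : comNzRingType) (Rg : nat -> set R) (I J : set R).
Variables (M : grmod Rg) (E : gr_inj_resolution M).

Definition cocycles (i : nat) : set (E i) :=
  [set x | torsion I J (E i) x /\ res_d E i x = 0].

Definition coboundaries (i : nat) : set (E i) :=
  match i with
  | 0 => [set 0]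
  | k.+1 => [set res_d E k x | x in torsion I J (E k)]
  end.

Arguments cocycles i _ : clear implicits.
Arguments coboundaries i _ : clear implicits.

Lemma coboundaries_submod i :
  ideal_of setT J -> submod_closed (mem (coboundaries i)).
Proof.
case: i => [|k] idJ /=.
  split=> [|c x y /set_mem/= -> /set_mem/= ->]; apply/mem_set => //=.
  by rewrite scaler0 addr0.
have [T0 Tlin] := torsion_submod I (E k) idJ.
split=> [|c x y /set_mem[x' /mem_set Tx' <-] /set_mem[y' /mem_set Ty' <-]].
  by apply/mem_set; exists 0; [exact: set_mem|rewrite raddf0].
apply/mem_set; exists (c *: x' + y'); last by rewrite linearP.
by apply: set_mem; apply: Tlin.
Qed.

(* The degree n component of H^i = Z^i / B^i, for the complex obtained by
   applying the torsion functor to the resolution E.  Here Z^i / B^i is seen as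
   a submodule of E^i / B^i; when J is an ideal, B^i is the submodule which it
   generates (coboundaries_submod, lspan_submod). *)
Definition loc_cohomology (i : nat) (n : int) :
    set (quotmod (coboundaries i)) :=
  [set quotmod_pi (coboundaries i) x | x in cocycles i `&` @grc _ _ (E i) n].

End LocalCohomology.

Arguments loc_cohomology {R Rg} I J {M} E i n.

(* Main.v *)
(* Since the derived functors are computed on injective resolutions, the long
   exact sequence is available (the category of graded modules has enough
   injectives: M embeds into the graded part of Hom_Z(R, prod (Q/Z))).

   Take M = R x cyclic, with m_0 M = 0, and let H^i stand for H^i_(b, m_0 R).  On
   M an element t of R_1 is nilpotent on classes: if z is a torsion cocycle then
   t^k z = c z with c in m_0 R, and m_0 kills H^i(M).  If t is M-regular, then
   H^(i-1)(M / t M)_n = 0 for n >> 0 (induction on i) makes t injective on H^i(M)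
   in high degrees, so that H^i(M)_n = 0.  If t is a zero-divisor with t x <> 0,
   then R t x and M / t M are cyclic with strictly larger annihilators, and
   Noetherian induction applies.  If R_1 x = 0, then M lives in one degree s and
   its injective resolutions are contractible in degrees > s.

   For an arbitrary cyclic M, the same dichotomy is applied to the elements a of
   m_0.  If a is M-regular, then H^i(M / a M)_n = 0 for n >> 0 gives
   H^i(M)_n = a H^i(M)_n, so that H^i(M)_n lies in all m_0^k H^i(M)_n.  Extensions
   then yield all finitely generated M. *)

Require Import Defs.
From HB Require Import structures.
From mathcomp Require Import all_boot all_order all_algebra.
From mathcomp Require Import boolp classical_sets functions.
From mathcomp Require Import zify ring.

Set Implicit Arguments.
Unset Strict Implicit.
Unset Printing Implicit Defensive.

Import Order.TTheory GRing.Theory Num.Theory.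
Local Open Scope ring_scope.
Local Open Scope classical_set_scope.

(** * Homogeneous components *)

(** The hypothesis concerns the single index i, whereas a regular element t of R_1 links H^i(M) to
    H^(i-1)(M / t M). Modules killed by m_0 are therefore settled for all indices, by nilpotence
    instead of separatedness. The hypothesis enters only with a regular element a of m_0, which has
    degree 0 and involves H^i(M / a M) alone. There it stands in for Nakayama's lemma, since the
    components of the cohomology are not known to be finitely generated over R_0.

    Torsion for a pair of ideals is delicate in a graded setting: I^n x in J x relates all the
    components of x at once, and does not say directly that each of them is torsion. A determinant
    trick shows that the torsion submodules are graded, so that classes can be treated degree by
    degree. Vanishing is then expressed by [coh_vanish], without quotients, and the long exact
    sequence by [coh_surj] and [coh_inj], in place of a connecting homomorphism. *)

Section Decomposition.
Variables (T : eqType) (V : zmodType).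

(** Values outside the list vanish, so that lists can be enlarged and two decompositions compared on
    a common one. *)
Definition finite_decomposition (P : T -> set V) (s : seq T) (f : T -> V) x :=
  [/\ uniq s, forall t, P t (f t), forall t, t \notin s -> f t = 0
    & x = \sum_(t <- s) f t].

Section Subgroups.
Variable P : T -> set V.
Hypothesis P0 : forall t, P t 0.
Hypothesis PB : forall t x y, P t x -> P t y -> P t (x - y).

Let PD t x y : P t x -> P t y -> P t (x + y).
Proof.
move=> Px Py; have -> : x + y = x - (0 - y) by rewrite sub0r opprK.
by apply: PB => //; apply: PB.
Qed.

(** A repeated index is handled by weighting its value with the multiplicity. *)
Lemma finite_decompositionP s f :
  (forall t, P t (f t)) ->
  exists s' f', finite_decomposition P s' f' (\sum_(t <- s) f t).
Proof.
move=> Pf; exists (undup s), (fun t => f t *+ count_mem t s); split.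
- exact: undup_uniq.
- move=> t; elim: (count_mem t s) => [|n IH]; first by rewrite mulr0n.
  by rewrite mulrS; apply: PD.
- by move=> t; rewrite mem_undup => /count_memPn->.
rewrite -[LHS](perm_big _ (perm_count_undup s)) big_flatten big_map /=.
by apply: eq_bigr => t _; rewrite big_nseq iter_addr_0.
Qed.

Lemma finite_decomposition_widen s s' f x :
  uniq s' -> {subset s <= s'} ->
  finite_decomposition P s f x -> finite_decomposition P s' f x.
Proof.
move=> us' ss' [us Pf f0 ->]; split=> // [t|].
  by move=> /(contra (ss' t))/f0.
rewrite [RHS](bigID (mem s)) /= [X in _ + X]big1 ?addr0; last first.
  by move=> t /f0.
rewrite -[RHS]big_filter; apply: perm_big; apply: uniq_perm => //.
  exact: filter_uniq.
by move=> t; rewrite mem_filter /=; case: (boolP (t \in s)) => // /ss'->.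
Qed.

Lemma finite_decomposition_common s1 f1 x1 s2 f2 x2 :
  finite_decomposition P s1 f1 x1 -> finite_decomposition P s2 f2 x2 ->
  exists s, finite_decomposition P s f1 x1 /\ finite_decomposition P s f2 x2.
Proof.
move=> D1 D2; exists (undup (s1 ++ s2)); split.
  apply: finite_decomposition_widen D1; first exact: undup_uniq.
  by move=> t; rewrite mem_undup mem_cat => ->.
apply: finite_decomposition_widen D2; first exact: undup_uniq.
by move=> t; rewrite mem_undup mem_cat orbC => ->.
Qed.

Lemma finite_decompositionB s f x g y :
  finite_decomposition P s f x -> finite_decomposition P s g y ->
  finite_decomposition P s (fun t => f t - g t) (x - y).
Proof.
move=> [us Pf f0 ->] [_ Pg g0 ->]; split=> // [t|t ts|].
- exact: PB.
- by rewrite f0 // g0 // subr0.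
- by rewrite sumrB.
Qed.

Definition decomposable : set V :=
  [set x | exists s f, finite_decomposition P s f x].

Lemma decomposable0 : decomposable 0.
Proof. by exists [::], (fun=> 0); split; rewrite ?big_nil. Qed.

Lemma decomposableB x y : decomposable x -> decomposable y ->
  decomposable (x - y).
Proof.
move=> [s1 [f1 D1]] [s2 [f2 D2]].
have [s [E1 E2]] := finite_decomposition_common D1 D2.
by exists s, (fun t => f1 t - f2 t); apply: finite_decompositionB.
Qed.

Lemma decomposableD x y : decomposable x -> decomposable y ->
  decomposable (x + y).
Proof.
move=> Dx Dy; have -> : x + y = x - (0 - y) by rewrite sub0r opprK.
apply: decomposableB => //.
by apply: decomposableB => //; exact: decomposable0.
Qed.

Lemma decomposable_sum (I : Type) (r : seq I) F :
  (forall i, decomposable (F i)) -> decomposable (\sum_(i <- r) F i).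
Proof.
move=> DF; elim/big_rec: _ => [|i x _ Dx]; first exact: decomposable0.
exact: decomposableD.
Qed.

Lemma decomposable_mem t x : P t x -> decomposable x.
Proof.
move=> Px; exists [:: t], (fun t' => if t' == t then x else 0); split=> //.
- by move=> t'; case: eqP => [->|].
- by move=> t'; rewrite inE => /negPf->.
- by rewrite big_seq1 eqxx.
Qed.

End Subgroups.

Section Projection.
Variables (G : T -> set V) (Gsum : direct_sum_decomposition G).

Let G0 t : G t 0. Proof. by case: Gsum => /(_ t)[]. Qed.
Let GB t x y : G t x -> G t y -> G t (x - y).
Proof. by case: Gsum => /(_ t)[_ + _ _]; apply. Qed.

Lemma finite_decomposition_exists x :
  exists sf : seq T * (T -> V), finite_decomposition G sf.1 sf.2 x.
Proof.
have [_ /(_ x)[s [f [Gf ->]]] _] := Gsum.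
by have [s' [f' D]] := finite_decompositionP G0 GB s Gf; exists (s', f').
Qed.

Definition dproj (t : T) (x : V) : V :=
  (projT1 (cid (finite_decomposition_exists x))).2 t.

Definition dsupp (x : V) : seq T :=
  (projT1 (cid (finite_decomposition_exists x))).1.

Lemma dproj_decomposition x :
  finite_decomposition G (dsupp x) (dproj^~ x) x.
Proof. by rewrite /dsupp /dproj; case: cid. Qed.

(** Two decompositions of x differ by a decomposition of 0, all of whose terms vanish. *)
Lemma dproj_unique s f x t :
  finite_decomposition G s f x -> dproj t x = f t.
Proof.
move=> D1; have D2 := dproj_decomposition x.
have [s' [E1 E2]] := finite_decomposition_common D1 D2.
have [us' Gh h0 hx] := finite_decompositionB GB E2 E1.
have [_ _ /(_ s' _ us' Gh)] := Gsum.
rewrite -hx subrr => /(_ erefl t).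
have [ts' /(_ isT)/eqP|/h0/eqP + _] := boolP (t \in s').
  by rewrite subr_eq0 => /eqP.
by rewrite subr_eq0 => /eqP.
Qed.

Lemma dproj_mem t x : G t (dproj t x).
Proof. by case: (dproj_decomposition x). Qed.

Lemma dprojB t : {morph dproj t : x y / x - y}.
Proof.
move=> x y; have Dx := dproj_decomposition x; have Dy := dproj_decomposition y.
have [s [Ex Ey]] := finite_decomposition_common Dx Dy.
exact: dproj_unique (finite_decompositionB GB Ex Ey).
Qed.

Lemma dproj_homog t t' x : G t x -> dproj t' x = if t' == t then x else 0.
Proof.
move=> Gx; pose f t0 := if t0 == t then x else 0.
apply: (@dproj_unique [:: t] f); rewrite /f; split=> //.
- by move=> t''; case: eqP => [->|].
- by move=> t''; rewrite inE => /negPf->.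
- by rewrite big_seq1 eqxx.
Qed.

Lemma dproj_id t x : G t x -> dproj t x = x.
Proof. by move/dproj_homog->; rewrite eqxx. Qed.

Lemma dproj_neq t t' x : t' != t -> G t x -> dproj t' x = 0.
Proof. by move=> /negPf n /dproj_homog->; rewrite n. Qed.

Lemma dproj_sum x : x = \sum_(t <- dsupp x) dproj t x.
Proof. by case: (dproj_decomposition x). Qed.

Lemma dproj_out t x : t \notin dsupp x -> dproj t x = 0.
Proof. by have [_ _ f0 _] := dproj_decomposition x => /f0. Qed.

End Projection.

(** Applying [pr t] to a vanishing sum isolates its term of index t. This serves for products and
    shifts, whose projections are known in advance. *)
Lemma direct_sum_of_proj (G : T -> set V) (pr : T -> V -> V) :
  (forall t x y, G t x -> G t y -> G t (x - y)) ->
  (forall t x, G t (pr t x)) ->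
  (forall t, {morph pr t : x y / x - y}) ->
  (forall t t' x, G t x -> pr t' x = if t' == t then x else 0) ->
  (forall x, exists s : seq T, x = \sum_(t <- s) pr t x) ->
  direct_sum_decomposition G.
Proof.
move=> GB Gpr prB prG prS.
have pr0 t : pr t 0 = 0 by have := prB t 0 0; rewrite !subrr.
have prD t x y : pr t (x + y) = pr t x + pr t y.
  have -> : x + y = x - (0 - y) by rewrite sub0r opprK.
  by rewrite !prB pr0 sub0r opprK.
split=> [t|x|s f us Gf f0 t ts].
- by split=> [|x y Gx Gy]; [rewrite -(pr0 t)|apply: GB].
- by have [s Es] := prS x; exists s, (pr^~ x).
have := congr1 (pr t) f0; rewrite pr0 (big_morph (pr t) (prD t) (pr0 t)).
rewrite (bigD1_seq t) //= (prG t) // eqxx big1 ?addr0 // => t' /negPf nt.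
by rewrite (prG t') // eq_sym nt.
Qed.

End Decomposition.

Arguments dproj {T V G} Gsum t x.
Arguments dsupp {T V G} Gsum x.

(** * Linear maps and generated submodules *)

Section LinearMaps.
Variables (R : comNzRingType) (A B : lmodType R).

Definition linear_pack (f : A -> B)
    (lf : forall a x y, f (a *: x + y) = a *: f x + f y) : {linear A -> B} :=
  HB.pack f (GRing.isLinear.Build R A B *:%R f lf).

Lemma linear_of (f : A -> B) :
  (forall a x y, f (a *: x + y) = a *: f x + f y) ->
  exists g : {linear A -> B}, g =1 f.
Proof. by move=> lf; exists (linear_pack lf). Qed.

Lemma lspan_ind (S : set A) (P : A -> Prop) :
  P 0 -> (forall x y, P x -> P y -> P (x + y)) ->
  (forall c x, S x -> P (c *: x)) ->
  forall x, lspan setT S x -> P x.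
Proof.
move=> P0 PD PZ x [p [c [a [_ Sa ->]]]].
by elim/big_rec: _ => // k y _ Py; apply: PD => //; apply: PZ.
Qed.

Lemma lspan_mem (S : set A) x : S x -> lspan setT S x.
Proof.
move=> Sx; exists 1%N, (fun=> 1), (fun=> x); split=> //.
by rewrite big_ord1 scale1r.
Qed.

Lemma lspan_lin (S : set A) c x y :
  lspan setT S x -> lspan setT S y -> lspan setT S (c *: x + y).
Proof.
move=> Sx Sy; have [_ L] := in_lspan_submod S.
exact: set_mem (L c x y (mem_set Sx) (mem_set Sy)).
Qed.

Lemma lspan0 (S : set A) : lspan setT S 0.
Proof. by have [L _] := in_lspan_submod S; exact: set_mem L. Qed.

Lemma lspanD (S : set A) x y :
  lspan setT S x -> lspan setT S y -> lspan setT S (x + y).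
Proof. by move=> Sx Sy; rewrite -(scale1r x); exact: lspan_lin. Qed.

Lemma lspanB (S : set A) x y :
  lspan setT S x -> lspan setT S y -> lspan setT S (x - y).
Proof. by move=> Sx Sy; rewrite addrC -scaleN1r; exact: lspan_lin. Qed.

Lemma lspanZ (S : set A) c x : lspan setT S x -> lspan setT S (c *: x).
Proof. by move=> Sx; rewrite -[c *: x]addr0; apply: lspan_lin (lspan0 S). Qed.

Lemma lspan_sum (S : set A) (I : Type) (r : seq I) F :
  (forall i, lspan setT S (F i)) -> lspan setT S (\sum_(i <- r) F i).
Proof.
by move=> SF; elim/big_rec: _ => [|i y _]; [exact: lspan0|exact: lspanD].
Qed.

End LinearMaps.

(** * Graded modules: components, submodules, quotients, sums and shifts *)

Section SpanModule.
Variables (R : comNzRingType) (V : lmodType R) (A : set V).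

Definition spanmod : Type := {x : V | in_lspan A x}.

HB.instance Definition _ := SubType.on spanmod.
HB.instance Definition _ := Choice.on spanmod.
HB.instance Definition _ := [SubChoice_isSubLmodule of spanmod by <:].

Definition spanmod_val : {linear spanmod -> V} := val.

Lemma spanmod_valP (x : spanmod) : lspan setT A (spanmod_val x).
Proof. by case: x => x /= /set_mem. Qed.

Lemma spanmod_valK x : lspan setT A x -> exists y, spanmod_val y = x.
Proof. by move=> /mem_set Ax; exists (exist _ x Ax). Qed.

Lemma spanmod_valZ a x : spanmod_val (a *: x) = a *: spanmod_val x.
Proof. exact: linearZ. Qed.

Lemma spanmod_valB x y : spanmod_val (x - y) = spanmod_val x - spanmod_val y.
Proof. exact: raddfB. Qed.

Lemma spanmod_val_sum (T : Type) (r : seq T) F :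
  spanmod_val (\sum_(i <- r) F i) = \sum_(i <- r) spanmod_val (F i).
Proof. exact: raddf_sum. Qed.

Lemma spanmod_val_inj : injective spanmod_val.
Proof. exact: val_inj. Qed.

End SpanModule.

Arguments spanmod_val {R V A}.

Section Graded.
Variables (R : comNzRingType) (Rg : nat -> set R).
Hypothesis Rgr : ring_grading Rg.

Lemma ring_sum : direct_sum_decomposition Rg.
Proof. by case: Rgr. Qed.

Definition rproj := dproj ring_sum.

(** The difference of two degrees in a module may be negative, where R has no component. *)
Definition rprojz (l : int) (r : R) : R := if l is Posz k then rproj k r else 0.

Lemma Rg0 k : Rg k 0.
Proof. by case: ring_sum => /(_ k)[]. Qed.

Lemma RgB k a b : Rg k a -> Rg k b -> Rg k (a - b).
Proof. by case: ring_sum => /(_ k)[_ + _ _]; apply. Qed.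

Lemma RgM i j a b : Rg i a -> Rg j b -> Rg (i + j)%N (a * b).
Proof. by case: Rgr => _ _; apply. Qed.

Lemma Rg1 : Rg 0%N 1.
Proof. by case: Rgr. Qed.

Lemma RgX i a k : Rg i a -> Rg (i * k)%N (a ^+ k).
Proof.
move=> Ga; elim: k => [|k IH]; first by rewrite muln0; exact: Rg1.
by rewrite exprS mulnS; apply: RgM.
Qed.

Section Module.
Variable M : grmod Rg.

Definition gproj := dproj (grc_sum M).

Lemma grc0 n : @grc _ _ M n 0.
Proof. by case: (grc_sum M) => /(_ n)[]. Qed.

Lemma grcB n (x y : M) : grc n x -> grc n y -> grc n (x - y).
Proof. by case: (grc_sum M) => /(_ n)[_ + _ _]; apply. Qed.

Lemma grcD n (x y : M) : grc n x -> grc n y -> grc n (x + y).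
Proof.
move=> Ga Gb; have -> : x + y = x - (0 - y) by rewrite sub0r opprK.
by apply: grcB => //; apply: grcB => //; exact: grc0.
Qed.

Lemma grcN n (x : M) : grc n x -> grc n (- x).
Proof. by move=> Gx; rewrite -sub0r; apply: grcB => //; exact: grc0. Qed.

Lemma grc_scale0 n a (x : M) : Rg 0%N a -> grc n x -> grc n (a *: x).
Proof. by move=> a0 /(grc_scale a0); rewrite add0r. Qed.

Lemma gprojB n : {morph gproj n : x y / x - y}.
Proof. exact: dprojB. Qed.

Lemma gproj0 n : gproj n 0 = 0.
Proof. by have := gprojB n 0 0; rewrite !subrr. Qed.

Lemma gprojN n : {morph gproj n : x / - x}.
Proof. by move=> x; rewrite -sub0r gprojB gproj0 sub0r. Qed.

Lemma gprojD n : {morph gproj n : x y / x + y}.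
Proof. by move=> x y; rewrite -{1}(opprK y) gprojB gprojN opprK. Qed.

Lemma gproj_sumr n (I : Type) (r : seq I) (F : I -> M) :
  gproj n (\sum_(i <- r) F i) = \sum_(i <- r) gproj n (F i).
Proof. exact: (big_morph _ (gprojD n) (gproj0 n)). Qed.

Lemma gproj_scale n k r (x : M) : grc k x ->
  gproj n (r *: x) = rprojz (n - k) r *: x.
Proof.
move=> Gx; rewrite {1}(dproj_sum ring_sum r) scaler_suml gproj_sumr.
have E l : gproj n (dproj ring_sum l r *: x) =
    if n == l%:Z + k then dproj ring_sum l r *: x else 0.
  by apply: dproj_homog; apply: grc_scale => //; exact: dproj_mem.
under eq_bigr do rewrite E.
case D: (n - k) => [l|l] /=; last first.
  rewrite scale0r big1 // => l' _; case: eqP => // nE.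
  by move: D; rewrite nE addrK.
have nE : n = l%:Z + k by rewrite -D subrK.
case: (boolP (l \in dsupp ring_sum r)) => ls.
  rewrite (bigD1_seq l) //=; last by case: (dproj_decomposition ring_sum r).
  rewrite nE eqxx big1 ?addr0 // => l' /negPf nl.
  by rewrite (inj_eq (addIr k)) eqz_nat eq_sym nl.
rewrite /rproj dproj_out // scale0r big1_seq // => l' /andP[_ l's].
rewrite nE (inj_eq (addIr k)) eqz_nat; case: eqP => // ll'.
by rewrite ll' l's in ls.
Qed.

Lemma gproj_scale_homog n l a (x : M) : Rg l a ->
  gproj (l%:Z + n) (a *: x) = a *: gproj n x.
Proof.
move=> Ga; rewrite {1}(dproj_sum (grc_sum M) x) scaler_sumr gproj_sumr.
have E k : gproj (l%:Z + n) (a *: dproj (grc_sum M) k x) =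
    if k == n then a *: dproj (grc_sum M) k x else 0.
  have -> : (k == n) = (l%:Z + n == l%:Z + k).
    by rewrite (inj_eq (addrI _)) eq_sym.
  by apply: dproj_homog; apply: grc_scale => //; exact: dproj_mem.
under eq_bigr do rewrite E.
case: (boolP (n \in dsupp (grc_sum M) x)) => ls.
  rewrite (bigD1_seq n) //=; last by case: (dproj_decomposition (grc_sum M) x).
  by rewrite eqxx big1 ?addr0 // => l' /negPf ->.
rewrite /gproj dproj_out // scaler0 big1_seq // => l' /andP[_ l's].
by case: eqP => // ll'; rewrite -ll' l's in ls.
Qed.

Definition homog_elements : set M := [set x | exists n, grc n x].

Lemma gproj_lspan (A : set M) : A `<=` homog_elements ->
  forall n x, lspan setT A x -> lspan setT A (gproj n x).
Proof.
move=> hA n; apply: lspan_ind => [|x y Ax Ay|c x Ax].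
- by rewrite gproj0; exact: lspan0.
- by rewrite gprojD; exact: lspanD.
have [k Gk] := hA x Ax; rewrite (gproj_scale _ _ Gk).
by apply: lspanZ; exact: lspan_mem.
Qed.

End Module.

Lemma homog_gproj (M N : grmod Rg) (f : {linear M -> N}) n x :
  homogeneous_map f -> f (gproj n x) = gproj n (f x).
Proof.
move=> hf; have [us _ f0 xE] := dproj_decomposition (grc_sum M) x.
rewrite [in RHS]xE linear_sum gproj_sumr.
have E k : gproj n (f (dproj (grc_sum M) k x)) =
    if n == k then f (dproj (grc_sum M) k x) else 0.
  by apply: dproj_homog; apply: hf; exact: dproj_mem.
under eq_bigr do rewrite E.
case: (boolP (n \in dsupp (grc_sum M) x)) => ns.
  by rewrite (bigD1_seq n) //= eqxx big1 ?addr0 // => l /negPf; rewrite eq_sym => ->.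
rewrite /gproj f0 // linear0 big1_seq // => l /andP[_ ls].
by case: eqP => // nl; rewrite nl ls in ns.
Qed.

Lemma homog_lspanT (M : grmod Rg) (x : M) : lspan setT (@homog_elements M) x.
Proof.
rewrite (dproj_sum (grc_sum M) x); apply: lspan_sum => k.
by apply: lspan_mem; exists k; exact: dproj_mem.
Qed.

(* A span of homogeneous elements of an arbitrary module V, the homogeneous
    components of which need not generate V. *)
Section SpanGrading.
Variables (V : lmodType R) (G : int -> set V) (A : set V).
Hypothesis GB : forall n x y, G n x -> G n y -> G n (x - y).
Hypothesis G0 : forall n, G n 0.
Hypothesis Gindep : forall (s : seq int) (f : int -> V), uniq s ->
  (forall n, G n (f n)) -> \sum_(n <- s) f n = 0 ->
  forall n, n \in s -> f n = 0.
Hypothesis Gscale : forall (i : nat) (n : int) a x,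
  Rg i a -> G n x -> G (i%:Z + n) (a *: x).
Hypothesis AG : forall x, A x -> exists n, G n x.

Definition span_grc (n : int) : set (spanmod A) := [set x | G n (@spanmod_val R V A x)].

Lemma span_direct_sum : direct_sum_decomposition span_grc.
Proof.
split=> [n|x|s f us Gf f0 n ns].
- split=> [|x y]; first exact: G0.
  by move=> Gx Gy; rewrite /span_grc /mkset raddfB; exact: GB.
(* The components must lie in the span itself, so the decomposition is sought among the elements
   that are both homogeneous and in the span. *)
- pose P n := [set y : V | G n y /\ lspan setT A y].
  have P0 n : P n 0 by split; [exact: G0|exact: lspan0].
  have PB n y z : P n y -> P n z -> P n (y - z).
    by move=> [Gy Ay] [Gz Az]; split; [exact: GB|exact: lspanB].
  suff [s [f [_ Pf _ xE]]] : decomposable P (spanmod_val x).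
    have /choice[g gE] : forall n, exists y : spanmod A, spanmod_val y = f n.
      by move=> n; apply: spanmod_valK; case: (Pf n).
    exists s, g; split=> [n|].
      by rewrite /span_grc /mkset gE; case: (Pf n).
    apply: spanmod_val_inj; rewrite xE raddf_sum.
    by apply: eq_bigr => n _; exact/esym/gE.
  move: (spanmod_val x) (spanmod_valP x) => {x}; apply: lspan_ind => [|y z Dy Dz|c y Ay].
  + exact: decomposable0.
  + exact: decomposableD.
  have [n Gy] := AG Ay; rewrite (dproj_sum ring_sum c) scaler_suml.
  apply: decomposable_sum => // k; apply: (@decomposable_mem _ _ _ _ (k%:Z + n)).
    exact: P0.
  split; last by apply: lspanZ; exact: lspan_mem.
  by apply: Gscale => //; exact: dproj_mem.
apply: spanmod_val_inj; rewrite raddf0.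
apply: (@Gindep s (fun n => spanmod_val (f n))) => //.
by rewrite -raddf_sum f0 raddf0.
Qed.

Lemma span_grc_scale i n a x : Rg i a -> span_grc n x ->
  span_grc (i%:Z + n) (a *: x).
Proof. by move=> Ra Gx; rewrite /span_grc /mkset linearZ; apply: Gscale. Qed.

Definition span_grmod : grmod Rg := GrMod span_direct_sum span_grc_scale.

End SpanGrading.

Section Submodule.
Variables (M : grmod Rg) (A : set M).
Hypothesis hA : A `<=` @homog_elements M.

Definition gsub : grmod Rg :=
  span_grmod (@grcB M) (@grc0 M) (let: And3 _ _ H := grc_sum M in H)
    (@grc_scale _ _ M) hA.

Definition gsub_val : {linear gsub -> M} := @spanmod_val _ _ A.

Lemma gsub_val_homog : homogeneous_map gsub_val.
Proof. by []. Qed.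

Lemma gsub_val_inj : injective gsub_val.
Proof. exact: val_inj. Qed.

Lemma gsub_val_range x : range gsub_val x <-> lspan setT A x.
Proof.
split=> [[y _ <-]|/spanmod_valK[y <-]]; first exact: spanmod_valP.
by exists y.
Qed.

Definition gquot_grc (n : int) : set (quotmod A) :=
  [set quotmod_pi A x | x in @grc _ _ M n].

Lemma gquot_direct_sum : direct_sum_decomposition gquot_grc.
Proof.
split=> [n|q|s f us Gf f0 n ns].
- split=> [|q q' [x Gx <-] [y Gy <-]]; first by exists 0; [exact: grc0|exact: raddf0].
  by exists (x - y); [exact: grcB|exact: raddfB].
- elim/quotmod_ind: q => x.
  exists (dsupp (grc_sum M) x), (fun n => quotmod_pi A (dproj (grc_sum M) n x)).
  split=> [n|]; first by exists (dproj (grc_sum M) n x) => //; exact: dproj_mem.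
  by rewrite -raddf_sum -dproj_sum.
have /choice[g gE] : forall n, exists x, @grc _ _ M n x /\ quotmod_pi A x = f n.
  by move=> k; have [x Gx xE] := Gf k; exists x.
have Ag : lspan setT A (\sum_(n <- s) g n).
  apply/quotmod_pi_eq0; rewrite raddf_sum -[RHS]f0.
  by apply: eq_bigr => k _; case: (gE k).
have [Gn <-] := gE n; apply/quotmod_pi_eq0.
(* The submodule is graded, so it contains the component of degree n of the lifted sum, which is
   [g n]. *)
have := gproj_lspan hA n Ag; rewrite gproj_sumr (bigD1_seq n) //= /gproj.
rewrite dproj_id // big1 ?addr0 // => k nk.
by apply: dproj_neq (proj1 (gE k)); rewrite eq_sym.
Qed.

Lemma gquot_grc_scale i n a x : Rg i a -> gquot_grc n x ->
  gquot_grc (i%:Z + n) (a *: x).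
Proof.
move=> Ra [y Gy <-]; exists (a *: y); first exact: grc_scale.
exact: linearZ.
Qed.

Definition gquot : grmod Rg := GrMod gquot_direct_sum gquot_grc_scale.

Definition gquot_pi : {linear M -> gquot} := quotmod_pi A.

Lemma gquot_pi_homog : homogeneous_map gquot_pi.
Proof. by move=> n x Gx; exists x. Qed.

Lemma gquot_pi_surj (q : gquot) : exists x, gquot_pi x = q.
Proof. by elim/quotmod_ind: q => x; exists x. Qed.

Lemma gquot_pi_eq0 x : gquot_pi x = 0 <-> lspan setT A x.
Proof. exact: quotmod_pi_eq0. Qed.

End Submodule.

Section Product.
Variables A B : grmod Rg.

Definition gprod_grc (n : int) : set (A * B)%type :=
  [set x | grc n x.1 /\ grc n x.2].

Lemma gprod_direct_sum : direct_sum_decomposition gprod_grc.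
Proof.
pose pr n (x : A * B) : (A * B)%type := (gproj n x.1, gproj n x.2).
apply: (direct_sum_of_proj (pr := pr)).
- by move=> n x y [Gx Hx] [Gy Hy]; split; apply: grcB.
- by move=> n x; split; exact: dproj_mem.
- by move=> n x y; congr pair; exact: gprojB.
- move=> n n' [x y] [/= Gx Gy]; rewrite /pr /gproj.
  by rewrite (dproj_homog _ _ Gx) (dproj_homog _ _ Gy); case: eqP.
move=> [x y]; have Dx := dproj_decomposition (grc_sum A) x.
have Dy := dproj_decomposition (grc_sum B) y.
set s := undup (dsupp (grc_sum A) x ++ dsupp (grc_sum B) y); exists s.
have us : uniq s by exact: undup_uniq.
have sx : {subset dsupp (grc_sum A) x <= s}.
  by move=> n; rewrite mem_undup mem_cat => ->.
have sy : {subset dsupp (grc_sum B) y <= s}.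
  by move=> n; rewrite mem_undup mem_cat orbC => ->.
have [_ _ _ xE] := finite_decomposition_widen us sx Dx.
have [_ _ _ yE] := finite_decomposition_widen us sy Dy.
rewrite [LHS]surjective_pairing [RHS]surjective_pairing.
congr pair.
  by rewrite (raddf_sum fst) /= [LHS]xE.
by rewrite (raddf_sum snd) /= [LHS]yE.
Qed.

Lemma gprod_grc_scale i n a x : Rg i a -> gprod_grc n x ->
  gprod_grc (i%:Z + n) (a *: x).
Proof. by move=> Ra [Gx Gy]; split; apply: grc_scale. Qed.

Definition gprod : grmod Rg := GrMod gprod_direct_sum gprod_grc_scale.

End Product.

Section Shift.
Variables (c : int) (M : grmod Rg).

Definition gshift_grc (n : int) : set M := @grc _ _ M (n + c).

Lemma gshift_direct_sum : direct_sum_decomposition gshift_grc.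
Proof.
apply: (direct_sum_of_proj (pr := fun n (x : M) => gproj (n + c) x)).
- by move=> n x y; exact: grcB.
- by move=> n x; exact: dproj_mem.
- by move=> n x y; exact: gprojB.
- move=> n n' x Gx; rewrite /gproj.
  rewrite (dproj_homog (grc_sum M) (n' + c) (Gx : grc (n + c) x)).
  by rewrite (inj_eq (addIr c)).
move=> x; exists [seq n - c | n <- dsupp (grc_sum M) x].
rewrite big_map [LHS](dproj_sum (grc_sum M)).
by apply: eq_bigr => n _; rewrite subrK.
Qed.

Lemma gshift_grc_scale i n a x : Rg i a -> gshift_grc n x ->
  gshift_grc (i%:Z + n) (a *: x).
Proof. by move=> Ra; rewrite /gshift_grc -addrA; exact: grc_scale. Qed.

Definition gshift : grmod Rg := GrMod gshift_direct_sum gshift_grc_scale.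

End Shift.

End Graded.

(** * Complexes of graded injectives *)

(** Dependent choice in a family of types: the successive maps of a chain map or of a homotopy have
    different sources and targets. *)
Lemma dependent_sequence (T : nat -> Type) (Inv : forall k, T k -> Prop)
    (Rel : forall k, T k -> T k.+1 -> Prop) (x0 : T 0%N) :
  Inv 0%N x0 ->
  (forall k x, Inv k x -> exists y, Inv k.+1 y /\ Rel k x y) ->
  exists s : forall k, T k,
    [/\ s 0%N = x0, forall k, Inv k (s k) & forall k, Rel k (s k) (s k.+1)].
Proof.
move=> I0 step.
have step' k (x : {x : T k | Inv k x}) : {y : {y : T k.+1 | Inv k.+1 y} |
    Rel k (projT1 x) (projT1 y)}.
  case: x => x Ix; have [y [Iy Rxy]] := cid (step k x Ix).
  by exists (exist _ y Iy).
pose s := fix s k : {x : T k | Inv k x} :=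
  if k is k'.+1 then projT1 (step' k' (s k')) else exist _ x0 I0.
exists (fun k => projT1 (s k)); split=> // k; first by case: (s k).
exact: (projT2 (step' k (s k))).
Qed.

Section Injectives.
Variables (R : comNzRingType) (Rg : nat -> set R).
Hypothesis Rgr : ring_grading Rg.
Implicit Types M N A B E : grmod Rg.

Section Extension.
Variables (A B E : grmod Rg) (d : {linear A -> B}) (f : {linear A -> E}).
Variable U : set int.
Hypothesis Uup : forall n (l : nat), U n -> U (l%:Z + n).
Hypotheses (Einj : gr_injective E) (dh : homogeneous_map d)
  (fh : homogeneous_map f).
Hypothesis dker : forall n x, U n -> grc n x -> d x = 0 -> f x = 0.

Let HU : set A := [set x | exists2 n, U n & grc n x].

(** Since U is closed upwards, the submodule generated in degrees of U lives in degrees of U; the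
    condition on kernels can be checked on components. *)
Let kerU x : lspan setT HU x -> d x = 0 -> f x = 0.
Proof.
move=> Ux dx; rewrite (dproj_sum (grc_sum A) x) linear_sum big1 // => n _.
have HUh : HU `<=` @homog_elements R Rg A by move=> y [k _ Gy]; exists k.
have Gn : @grc _ _ A n (gproj n x) by exact: dproj_mem.
have dn : d (gproj n x) = 0 by rewrite homog_gproj // dx gproj0.
have [Un|nUn] := pselect (U n); first exact: (dker Un).
suff -> : dproj (grc_sum A) n x = 0 by rewrite linear0.
move: Ux nUn; clear -Rgr Uup; move: x; apply: lspan_ind => [|x y x0 y0|c x].
- by move=> _; exact: gproj0.
- by move=> nU; have := gprojD n x y; rewrite /gproj x0 // y0 // addr0.
move=> [k Uk Gx] nU; have := gproj_scale Rgr n c Gx; rewrite /gproj => ->.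
case D: (n - k) => [l|l] /=; last by rewrite scale0r.
by case: nU; rewrite -[n](subrK k) D; exact: Uup.
Qed.

(** On the submodule generated in degrees of U, f factors through the image of d, and injectivity
    extends the factor to B. With U everything this is the usual extension; U = { n > s } allows M
    to be ignored up to degree s. *)
Lemma gr_injective_extend : exists2 g : {linear B -> E}, homogeneous_map g &
  forall n x, U n -> grc n x -> g (d x) = f x.
Proof.
pose D : set B := [set y | exists n x, [/\ U n, grc n x & d x = y]].
have hD : D `<=` @homog_elements R Rg B.
  by move=> y [n [x [_ Gx <-]]]; exists n; exact: dh.
have liftD y : lspan setT D y -> exists x, lspan setT HU x /\ d x = y.
  move: y; apply: lspan_ind => [|y z [x [Ux <-]] [x' [Ux' <-]]|c y].
  - by exists 0; split; [exact: lspan0|exact: linear0].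
  - by exists (x + x'); split; [exact: lspanD|exact: linearD].
  move=> [n [x [Un Gx <-]]]; exists (c *: x); split; last exact: linearZ.
  by apply: lspanZ; apply: lspan_mem; exists n.
pose S := gsub Rgr hD; pose v : {linear S -> B} := gsub_val Rgr hD.
have /choice[t tP] : forall y : S, exists x, lspan setT HU x /\ d x = v y.
  by move=> y; apply: liftD; exact: spanmod_valP.
(* The preimages chosen by [t] are arbitrary, but [f \o t] does not depend on them; hence it is
   linear and homogeneous. *)
have uniq_t x y : lspan setT HU x -> d x = v y -> f x = f (t y).
  move=> Ux dx; have [Ut dt] := tP y.
  apply/eqP; rewrite -subr_eq0 -linearB; apply/eqP/kerU; first exact: lspanB.
  by rewrite linearB dx dt subrr.
have [g gE] : exists g : {linear S -> E}, g =1 f \o t.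
  apply: linear_of => a x y /=; rewrite -linearP; apply/esym/uniq_t.
    by apply: lspan_lin; [case: (tP x)|case: (tP y)].
  by rewrite !linearP; case: (tP x) => _ ->; case: (tP y) => _ ->.
have gh : homogeneous_map g.
  move=> n y Gy; rewrite gE /= -(@uniq_t (gproj n (t y))).
  - by apply: fh; exact: dproj_mem.
  - apply: gproj_lspan => //; last by case: (tP y).
    by move=> x [k _ Gx]; exists k.
  rewrite homog_gproj //; case: (tP y) => _ ->.
  by rewrite /gproj dproj_id //; exact: Gy.
have [h hh hE] := Einj (gsub_val_homog (hA := hD)) gh (@gsub_val_inj _ _ Rgr _ _ hD).
exists h => // n x Un Gx.
have [y yE] : exists y : S, v y = d x.
  by apply: spanmod_valK; apply: lspan_mem; exists n, x.
rewrite -yE; rewrite [LHS]hE gE /=; apply/esym/uniq_t => //.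
by apply: lspan_mem; exists n.
Qed.

End Extension.

Lemma linear_ext_homog A B (f g : {linear A -> B}) :
  (forall n x, grc n x -> f x = g x) -> f =1 g.
Proof.
move=> fg x; have := homog_lspanT x; move: x.
apply: lspan_ind => [|x y fx fy|c x [n Gx]]; first by rewrite !linear0.
  by rewrite !linearD fx fy.
by rewrite !linearZ (fg n).
Qed.

Lemma gr_injective_extendT A B E (d : {linear A -> B}) (f : {linear A -> E}) :
  gr_injective E -> homogeneous_map d -> homogeneous_map f ->
  (forall x, d x = 0 -> f x = 0) ->
  exists2 g : {linear B -> E}, homogeneous_map g & forall x, g (d x) = f x.
Proof.
move=> Einj dh fh dker; have [] := @gr_injective_extend _ _ _ d f setT => //.
  by move=> n x _ _; exact: dker.
move=> g gh gE; exists g => // x.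
by apply: (@linear_ext_homog _ _ (g \o d) f) => n y; exact: gE.
Qed.

Lemma res_dd M (E : gr_inj_resolution M) k x :
  res_d E k.+1 (res_d E k x) = 0.
Proof.
have : range (res_d E k) (res_d E k x) by exists x.
by rewrite res_exactS.
Qed.

Lemma res_d_aug M (E : gr_inj_resolution M) m : res_d E 0%N (res_aug E m) = 0.
Proof.
have : range (res_aug E) (res_aug E m) by exists m.
by rewrite res_exact0.
Qed.

Lemma res_cocycle M (E : gr_inj_resolution M) k n x :
  grc n x -> res_d E k.+1 x = 0 -> exists2 y, grc n y & res_d E k y = x.
Proof.
move=> Gx dx; have : range (res_d E k) x by rewrite res_exactS.
move=> [y _ yx]; exists (gproj n y); first exact: dproj_mem.
rewrite homog_gproj //; last exact: res_d_homog.
by rewrite yx /gproj dproj_id.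
Qed.

Lemma res_cocycle0 M (E : gr_inj_resolution M) n x :
  grc n x -> res_d E 0%N x = 0 -> exists2 m, grc n m & res_aug E m = x.
Proof.
move=> Gx dx; have : range (res_aug E) x by rewrite res_exact0.
move=> [y _ yx]; exists (gproj n y); first exact: dproj_mem.
rewrite homog_gproj //; last exact: res_aug_homog.
by rewrite yx /gproj dproj_id.
Qed.

(** The target is only a complex of injectives, so that the truncated resolution with terms
    [E' k.+1] is allowed: this gives the twisting maps of the horseshoe. *)
Lemma chain_lift M (E : gr_inj_resolution M) (B : nat -> grmod Rg)
    (dB : forall k, {linear B k -> B k.+1}) (v : {linear M -> B 0%N}) :
  (forall k, gr_injective (B k)) -> (forall k, homogeneous_map (dB k)) ->
  (forall k x, dB k.+1 (dB k x) = 0) -> homogeneous_map v ->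
  (forall m, dB 0%N (v m) = 0) ->
  exists phi : forall k, {linear E k -> B k},
    [/\ forall k, homogeneous_map (phi k),
        forall m, phi 0%N (res_aug E m) = v m
      & forall k x, phi k.+1 (res_d E k x) = dB k (phi k x)].
Proof.
move=> Binj dBh dBB vh dBv.
have [|||p0 p0h p0E] := @gr_injective_extendT _ _ _ (res_aug E) v (Binj 0%N).
- exact: res_aug_homog.
- exact: vh.
- by move=> x x0; rewrite (@res_aug_inj _ _ _ E x 0) ?linear0.
(* The second clause is the condition on kernels under which [dB k \o p] extends along
   [res_d E k]. *)
pose Inv k (p : {linear E k -> B k}) := homogeneous_map p /\
  forall x, res_d E k x = 0 -> dB k (p x) = 0.
pose Rel k (p : {linear E k -> B k}) (q : {linear E k.+1 -> B k.+1}) :=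
  forall x, q (res_d E k x) = dB k (p x).
have [||s [s0 Is Rs]] := @dependent_sequence _ Inv Rel p0.
- split=> // x dx; have : range (res_aug E) x by rewrite res_exact0.
  by move=> [m _ <-]; rewrite p0E.
- move=> k p [ph pd].
  have [|||q qh qE] := @gr_injective_extendT _ _ _ (res_d E k) (dB k \o p)
    (Binj k.+1).
  + exact: res_d_homog.
  + by move=> n x Gx; apply: dBh; exact: ph.
  + by move=> x dx /=; exact: pd.
  exists q; split=> //; split=> // x dx.
  have : range (res_d E k) x by rewrite res_exactS.
  by move=> [y _ <-]; rewrite qE /= dBB.
exists s; split=> // [k|m]; first by case: (Is k).
by rewrite s0.
Qed.

(* Both the uniqueness of lifts up to homotopy and the contractibility of a
   resolution in the degrees where its module vanishes are instances. *)
Lemma chain_homotopy M (E : gr_inj_resolution M) (U : set int)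
    (B : nat -> grmod Rg) (dB : forall k, {linear B k -> B k.+1})
    (f : forall k, {linear E k -> B k}) :
  (forall n (l : nat), U n -> U (l%:Z + n)) ->
  (forall k, gr_injective (B k)) -> (forall k, homogeneous_map (dB k)) ->
  (forall k x, dB k.+1 (dB k x) = 0) ->
  (forall k, homogeneous_map (f k)) ->
  (forall k x, f k.+1 (res_d E k x) = dB k (f k x)) ->
  (forall n m, U n -> grc n m -> f 0%N (res_aug E m) = 0) ->
  exists h : forall k, {linear E k.+1 -> B k},
    [/\ forall k, homogeneous_map (h k),
        forall n x, U n -> grc n x -> h 0%N (res_d E 0%N x) = f 0%N x
      & forall k n x, U n -> grc n x ->
          h k.+1 (res_d E k.+1 x) = f k.+1 x - dB k (h k x)].
Proof.
move=> Uup Binj dBh dBB fh fd f0.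
have [|||||h0 h0h h0E] := @gr_injective_extend _ _ _ (res_d E 0%N) (f 0%N) U.
- exact: Uup.
- exact: Binj.
- exact: res_d_homog.
- exact: fh.
- by move=> n x Un Gx /(res_cocycle0 Gx)[m Gm <-]; exact: f0 Un Gm.
(* The second clause makes [f - dB h] vanish on cocycles one step further: on x = d y it equals dB
   (f y - h (d y)). *)
pose Inv k (h : {linear E k.+1 -> B k}) := homogeneous_map h /\
  forall n x, U n -> grc n x -> dB k (f k x - h (res_d E k x)) = 0.
pose Rel k (h : {linear E k.+1 -> B k}) (h' : {linear E k.+2 -> B k.+1}) :=
  forall n x, U n -> grc n x -> h' (res_d E k.+1 x) = f k.+1 x - dB k (h x).
have [||s [s0 Is Rs]] := @dependent_sequence _ Inv Rel h0.
- by split=> // n x Un Gx; rewrite (h0E n) // subrr linear0.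
- move=> k h [hh hE].
  have [g gE] : exists g : {linear E k.+1 -> B k.+1},
      g =1 (fun x => f k.+1 x - dB k (h x)).
    apply: linear_of => a x y; rewrite !linearP /=.
    by rewrite [in RHS]scalerDr addrACA.
  have [|||||h' h'h h'E] := @gr_injective_extend _ _ _ (res_d E k.+1) g U.
  + exact: Uup.
  + exact: Binj.
  + exact: res_d_homog.
  + by move=> n x Gx; rewrite gE; apply: grcB; [exact: fh|apply: dBh; exact: hh].
  + move=> n x Un Gx /(res_cocycle Gx)[y Gy <-].
    by rewrite gE fd -linearB (hE n).
  exists h'; split; last by move=> n x Un Gx; rewrite (h'E n) // gE.
  split=> // n x Un Gx; rewrite (h'E n) // gE opprB addrCA subrr.
  by rewrite addr0 dBB.
exists s; split=> [k|n x Un Gx|]; [by case: (Is k)| |exact: Rs].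
by rewrite s0 (h0E n).
Qed.

End Injectives.

(** * Long exact sequence *)

Section Cohomology.
Variables (R : comNzRingType) (Rg : nat -> set R).
Hypothesis Rgr : ring_grading Rg.
Variables I J : set R.
Hypothesis idJ : ideal_of setT J.
Implicit Types M N A B : grmod Rg.

Lemma torsion0 (V : lmodType R) : torsion I J V 0.
Proof. by have [T0 _] := torsion_submod I V idJ; exact: set_mem. Qed.

Lemma torsionP (V : lmodType R) a x y :
  torsion I J V x -> torsion I J V y -> torsion I J V (a *: x + y).
Proof.
move=> Tx Ty; have [_ TD] := torsion_submod I V idJ.
exact: set_mem (TD a x y (mem_set Tx) (mem_set Ty)).
Qed.

Lemma torsionZ (V : lmodType R) a x : torsion I J V x -> torsion I J V (a *: x).
Proof. by move=> Tx; rewrite -[_ *: _]addr0; apply: torsionP (torsion0 V). Qed.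

Lemma torsionD (V : lmodType R) x y :
  torsion I J V x -> torsion I J V y -> torsion I J V (x + y).
Proof. by move=> Tx Ty; rewrite -[x]scale1r; exact: torsionP. Qed.

Lemma torsionB (V : lmodType R) x y :
  torsion I J V x -> torsion I J V y -> torsion I J V (x - y).
Proof. by move=> Tx Ty; rewrite addrC -scaleN1r; exact: torsionP. Qed.

Lemma torsion_map (V W : lmodType R) (f : {linear V -> W}) x :
  torsion I J V x -> torsion I J W (f x).
Proof.
move=> [n0 H]; exists n0 => n n0n a Ia; have [b Jb E] := H n n0n a Ia.
by exists b; rewrite // -!linearZ E.
Qed.

Definition hcocycles M (E : gr_inj_resolution M) i n : set (E i) :=
  [set z | [/\ torsion I J (E i) z, grc n z & res_d E i z = 0]].

(** Unlike in [coboundaries], the preimage is homogeneous; [loc_cohomology0P] reconciles the two. *)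
Definition hcoboundaries M (E : gr_inj_resolution M) i n : set (E i) :=
  match i with
  | 0 => [set 0]
  | k.+1 => [set z | exists y, [/\ torsion I J (E k) y, grc n y
                                 & res_d E k y = z]]
  end.

Arguments hcocycles {M} E i n _.
Arguments hcoboundaries {M} E i n _.

Definition coh_vanish M (E : gr_inj_resolution M) i n :=
  forall z, hcocycles E i n z -> hcoboundaries E i n z.

Definition chain_map M N (E : gr_inj_resolution M) (F : gr_inj_resolution N)
    (f : forall k, {linear E k -> F k}) :=
  (forall k, homogeneous_map (f k)) /\
  forall k x, f k.+1 (res_d E k x) = res_d F k (f k x).

Section Basics.
Variables (M : grmod Rg) (E : gr_inj_resolution M).

Lemma hcobD i n x y :
  hcoboundaries E i n x -> hcoboundaries E i n y -> hcoboundaries E i n (x + y).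
Proof.
case: i x y => [|i] x y /=; first by move=> -> ->; rewrite addr0.
move=> [a [Ta Ga <-]] [b [Tb Gb <-]]; exists (a + b); split.
- exact: torsionD.
- exact: grcD.
- exact: linearD.
Qed.

Lemma hcob0 i n : hcoboundaries E i n 0.
Proof.
case: i => [//|i]; exists 0; split; [exact: torsion0|exact: grc0|exact: linear0].
Qed.

Lemma hcob_scale i n l a x : Rg l a ->
  hcoboundaries E i n x -> hcoboundaries E i (l%:Z + n) (a *: x).
Proof.
move=> Ra; case: i x => [|i] x /=; first by move=> ->; rewrite scaler0.
move=> [y [Ty Gy <-]]; exists (a *: y); split.
- exact: torsionZ.
- exact: grc_scale.
- exact: linearZ.
Qed.

Lemma hcoc_scale i n l a x : Rg l a ->
  hcocycles E i n x -> hcocycles E i (l%:Z + n) (a *: x).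
Proof.
move=> Ra [Tx Gx dx]; split; [exact: torsionZ|exact: grc_scale|].
by rewrite linearZ /= dx scaler0.
Qed.

End Basics.

Section ChainMaps.
Variables (M N : grmod Rg) (E : gr_inj_resolution M) (F : gr_inj_resolution N).
Variable f : forall k, {linear E k -> F k}.
Hypothesis fch : chain_map f.

Lemma hcoc_map i n x : hcocycles E i n x -> hcocycles F i n (f i x).
Proof.
case: fch => fh fd [Tx Gx dx]; split; [exact: torsion_map|exact: fh|].
by rewrite -fd dx linear0.
Qed.

Lemma hcob_map i n x : hcoboundaries E i n x -> hcoboundaries F i n (f i x).
Proof.
case: fch => fh fd; case: i x => [|i] x /=; first by move=> ->; rewrite linear0.
move=> [y [Ty Gy <-]]; exists (f i y).
by split; [exact: torsion_map|exact: fh|rewrite fd].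
Qed.

(** The difference f - g vanishes on M, hence is null-homotopic, and the homotopy preserves torsion
    because it is linear. On a cocycle x this gives f x - g x = d (h x). *)
Lemma homotopic_hcob (g : forall k, {linear E k -> F k}) i n x :
  chain_map g -> (forall m, f 0%N (res_aug E m) = g 0%N (res_aug E m)) ->
  hcocycles E i n x -> hcoboundaries F i n (f i x - g i x).
Proof.
move=> [gh gd] fg [Tx Gx dx]; case: fch => fh fd.
have lin k a y z : f k (a *: y + z) - g k (a *: y + z) =
    a *: (f k y - g k y) + (f k z - g k z).
  by rewrite !linearP /= [in RHS]scalerDr addrACA.
have [|||||||h [hh h0 hS]] := @chain_homotopy _ _ Rgr _ E setT F (res_d F)
  (fun k => linear_pack (lin k)).
- by [].
- by move=> k; exact: res_inj.
- by move=> k; exact: res_d_homog.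
- by move=> k y; exact: res_dd.
- by move=> k m y Gy; apply: grcB; [exact: fh|exact: gh].
- by move=> k y; rewrite /= linearB fd gd.
- by move=> m y _ _ /=; rewrite fg subrr.
case: i x Tx Gx dx => [|i] x Tx Gx dx.
  by have := h0 n x Logic.I Gx; rewrite dx linear0 => /esym.
have /esym/eqP := hS i n x Logic.I Gx; rewrite dx linear0 subr_eq0 => /eqP /= E1.
rewrite /= in E1 *; exists (h i x); split; [exact: torsion_map|exact: hh|].
by rewrite E1.
Qed.

End ChainMaps.

Lemma chain_lift_res M N (E : gr_inj_resolution M) (F : gr_inj_resolution N)
    (u : {linear M -> N}) : homogeneous_map u ->
  exists f : forall k, {linear E k -> F k},
    chain_map f /\ forall m, f 0%N (res_aug E m) = res_aug F (u m).
Proof.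
move=> uh.
have [|||||f [fh f0 fd]] := @chain_lift _ _ Rgr _ E F (res_d F) (res_aug F \o u).
- by move=> k; exact: res_inj.
- by move=> k; exact: res_d_homog.
- by move=> k y; exact: res_dd.
- by move=> n x Gx; apply: res_aug_homog; exact: uh.
- by move=> m; exact: res_d_aug.
by exists f.
Qed.

Lemma gprod_injective A B :
  gr_injective A -> gr_injective B -> gr_injective (gprod A B).
Proof.
move=> iA iB X Y u f uh fh uI.
pose f1 : {linear X -> A} := linear_pack (f := fun x => (f x).1)
  (fun a x y => congr1 fst (linearP f a x y)).
pose f2 : {linear X -> B} := linear_pack (f := fun x => (f x).2)
  (fun a x y => congr1 snd (linearP f a x y)).
have [g1 g1h g1E] := iA X Y u f1 uh (fun n x Gx => (fh n x Gx).1) uI.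
have [g2 g2h g2E] := iB X Y u f2 uh (fun n x Gx => (fh n x Gx).2) uI.
have gl a x y : (g1 (a *: x + y), g2 (a *: x + y)) =
    a *: ((g1 x, g2 x) : gprod A B) + ((g1 y, g2 y) : gprod A B).
  by rewrite !linearP.
exists (linear_pack gl).
  by move=> n x Gx; split; [exact: g1h|exact: g2h].
by move=> x /=; rewrite g1E g2E [RHS]surjective_pairing.
Qed.

Section Exact.
Variables (M' M M'' : grmod Rg) (u : {linear M' -> M}) (p : {linear M -> M''}).
Hypotheses (uh : homogeneous_map u) (ph : homogeneous_map p).
Hypotheses (uinj : injective u) (psurj : forall y, exists x, p x = y).
Hypothesis up0 : forall x, p x = 0 <-> exists y, u y = x.
Variables (E' : gr_inj_resolution M') (E : gr_inj_resolution M)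
  (E'' : gr_inj_resolution M'').

Let p_u y : p (u y) = 0. Proof. by apply/up0; exists y. Qed.

(* The horseshoe lemma: a resolution of M whose terms are the direct sums of
   those of E' and E''. *)
Section Horseshoe.
Variables (h : {linear M -> E' 0%N})
  (delta : forall k, {linear E'' k -> E' k.+1}).
Hypotheses (hh : homogeneous_map h) (dh : forall k, homogeneous_map (delta k)).
Hypothesis hu : forall y, h (u y) = res_aug E' y.
Hypothesis delta0 : forall m,
  delta 0%N (res_aug E'' (p m)) = res_d E' 0%N (h m).
Hypothesis deltaS : forall k x,
  delta k.+1 (res_d E'' k x) = res_d E' k.+1 (delta k x).

Let H k : grmod Rg := gprod (E' k) (E'' k).

(** With the minus sign on the second factor, d d = 0 means that [delta] commutes with the
    differentials, which is what [chain_lift] provides. *)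
Fact horseshoe_d_lin k a (x y : H k) (D := fun x : H k =>
    (res_d E' k x.1 - delta k x.2, - res_d E'' k x.2) : H k.+1) :
  D (a *: x + y) = a *: D x + D y.
Proof.
rewrite /D /= !linearP /=; congr pair => /=.
by rewrite [in RHS]scalerDr addrACA.
Qed.

Definition horseshoe_d k : {linear H k -> H k.+1} :=
  linear_pack (@horseshoe_d_lin k).

Fact horseshoe_aug_lin a (x y : M) (D := fun x : M =>
    (h x, res_aug E'' (p x)) : H 0%N) :
  D (a *: x + y) = a *: D x + D y.
Proof. by rewrite /D !linearP. Qed.

Definition horseshoe_aug : {linear M -> H 0%N} := linear_pack horseshoe_aug_lin.

Lemma horseshoe_inj k : gr_injective (H k).
Proof. by apply: gprod_injective; exact: res_inj. Qed.

Lemma horseshoe_d_homog k : homogeneous_map (horseshoe_d k).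
Proof.
move=> n x [Gx1 Gx2]; split => /=.
  by apply: grcB; [exact: res_d_homog|exact: dh].
by apply: grcN; exact: res_d_homog.
Qed.

Lemma horseshoe_aug_homog : homogeneous_map horseshoe_aug.
Proof. by move=> n x Gx; split; [exact: hh|apply: res_aug_homog; exact: ph]. Qed.

Lemma horseshoe_aug_inj : injective horseshoe_aug.
Proof.
move=> x y [h0 /(@res_aug_inj _ _ _ E'')px].
apply/eqP; rewrite -subr_eq0; apply/eqP.
have /up0[z zE] : p (x - y) = 0 by rewrite linearB px subrr.
have := hu z; rewrite zE linearB h0 subrr -(linear0 (res_aug E')).
by move=> /(@res_aug_inj _ _ _ E') z0; rewrite -zE -z0 linear0.
Qed.

Lemma horseshoe_exact0 :
  range horseshoe_aug = [set x | horseshoe_d 0%N x = 0].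
Proof.
apply/seteqP; split=> [_ [m _ <-]|[x1 x2]] /=.
  by rewrite delta0 subrr res_d_aug oppr0.
move=> [d1 /eqP]; rewrite oppr_eq0 => /eqP d2.
have : range (res_aug E'') x2 by rewrite res_exact0.
move=> [m'' _ x2E]; have [m mE] := psurj m''.
have : range (res_aug E') (x1 - h m).
  by rewrite res_exact0 /= linearB -delta0 mE x2E.
move=> [y _ yE]; exists (m + u y) => //=.
by rewrite !linearD hu yE p_u linear0 addr0 mE x2E addrC subrK.
Qed.

Lemma horseshoe_exactS k :
  range (horseshoe_d k) = [set x | horseshoe_d k.+1 x = 0].
Proof.
apply/seteqP; split=> [_ [x _ <-]|[x1 x2]] /=.
  by rewrite linearB linearN deltaS !res_dd sub0r subrr linearN res_dd !oppr0.
move=> [d1 /eqP]; rewrite oppr_eq0 => /eqP d2.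
have : range (res_d E'' k) x2 by rewrite res_exactS.
move=> [y2 _ x2E].
have : range (res_d E' k) (x1 - delta k y2).
  by rewrite res_exactS /= linearB -deltaS x2E.
move=> [y1 _ yE]; exists ((y1, - y2) : H k) => //=.
by rewrite !linearN !opprK yE x2E subrK.
Qed.

Definition horseshoe : gr_inj_resolution M :=
  GrInjResolution horseshoe_inj horseshoe_d_homog horseshoe_aug_homog
    horseshoe_aug_inj horseshoe_exact0 horseshoe_exactS.

Definition horseshoe_i1 k : {linear E' k -> horseshoe k} :=
  linear_pack (f := fun x => (x, 0) : horseshoe k) (fun a x y =>
    f_equal (pair (a *: x + y))
      (esym (etrans (addr0 _) (scaler0 _ a)))).

Lemma horseshoe_i1_chain : chain_map horseshoe_i1.
Proof.
split=> [k n x Gx|k x]; first by split=> //; exact: grc0.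
by congr pair; rewrite /= linear0 ?subr0 ?oppr0.
Qed.

Lemma horseshoe_i1_aug y :
  horseshoe_i1 0%N (res_aug E' y) = res_aug horseshoe (u y).
Proof. by rewrite /= hu p_u linear0. Qed.

Lemma torsion_fst k (x : horseshoe k) :
  torsion I J (horseshoe k) x -> torsion I J (E' k) x.1.
Proof.
exact: (@torsion_map (horseshoe k) (E' k)
  (linear_pack (f := fst) (fun a x y => erefl)) x).
Qed.

Lemma torsion_snd k (x : horseshoe k) :
  torsion I J (horseshoe k) x -> torsion I J (E'' k) x.2.
Proof.
exact: (@torsion_map (horseshoe k) (E'' k)
  (linear_pack (f := snd) (fun a x y => erefl)) x).
Qed.

Lemma torsion_i2 k (x : E'' k) :
  torsion I J (E'' k) x -> torsion I J (horseshoe k) (0, x).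
Proof.
apply: (@torsion_map (E'' k) (horseshoe k) (linear_pack (f := fun x => (0, x) :
  horseshoe k) (fun a x y => f_equal (fun z => (z, a *: x + y) : horseshoe k)
    (esym (etrans (addr0 _) (scaler0 _ a))))) x).
Qed.

Variable f : forall k, {linear E' k -> E k}.
Hypotheses (fch : chain_map f)
  (faug : forall m, f 0%N (res_aug E' m) = res_aug E (u m)).

(** Torsion of a direct sum is computed factorwise, so on the horseshoe the claim is a computation
    with pairs. The lifts G and g of the identity of M transport it to and from the given resolution
    E. *)
Lemma horseshoe_coh_surj i n z : coh_vanish E'' i n -> hcocycles E i n z ->
  exists x, hcocycles E' i n x /\ hcoboundaries E i n (z - f i x).
Proof.
move=> van Zz.
have [G [Gch Gaug]] := @chain_lift_res _ _ E horseshoe idfun (fun n x Gx => Gx).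
have [g [gch gaug]] := @chain_lift_res _ _ horseshoe E idfun (fun n x Gx => Gx).
have [TG GG dG] := hcoc_map Gch Zz.
have Z2 : hcocycles E'' i n (G i z).2.
  split; [exact: torsion_snd|by case: GG|].
  by move: dG => /(congr1 snd)/eqP; rewrite /= oppr_eq0 => /eqP.
have [x [Zx Bx]] : exists x, hcocycles E' i n x /\
    hcoboundaries horseshoe i n (G i z - horseshoe_i1 i x).
  move: (van _ Z2) TG GG dG => {Zz Z2}.
  move: (G i z) => {z van}; case: i => [|i] [x1 x2] /=.
    move=> -> T [Gx1 _] [d1 _]; exists x1; split.
      split; [exact: (torsion_fst T)|exact: Gx1|].
      by rewrite linear0 subr0 in d1.
    by rewrite subrr.
  move=> [w [Tw Gw <-]] T [Gx1 _] [/eqP d1 _].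
  (* The boundary of (0, - w) is (delta w, d w) and d w is the second component of the cocycle;
     subtracting it leaves this element of E'. *)
  exists (x1 - delta i w); split.
    split; [|by apply: grcB => //; exact: dh|].
      by apply: torsionB; [exact: (torsion_fst T)|exact: torsion_map].
    by apply/eqP; rewrite linearB -deltaS.
  exists ((0, - w) : horseshoe i); split.
  - by apply: torsion_i2; rewrite -scaleN1r; exact: torsionZ.
  - by split; [exact: grc0|exact: grcN].
  congr pair => /=; last by rewrite subr0 (linearN (res_d E'' i)) opprK.
  by rewrite (linearN (delta i)) linear0 sub0r opprK opprB addrCA subrr addr0.
exists x; split=> //.
(* The outer terms are boundaries by homotopy: g G and the identity both lift the identity of M, and
   g composed with the inclusion lifts u, as f does. *)
have -> : z - f i x = (z - g i (G i z)) + (g i (G i z - horseshoe_i1 i x)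
    + (g i (horseshoe_i1 i x) - f i x)).
  by rewrite linearB !addrA !subrK.
apply: hcobD; last apply: hcobD.
- apply: (@homotopic_hcob _ _ E E (fun k => idfun) _ (fun k => g k \o G k)) => //.
    by split=> [k m y Gy|k y].
    split=> [k m y Gy|k y]; first exact: (gch.1 k m _ (Gch.1 k m _ Gy)).
    exact: etrans (congr1 (g k.+1) (Gch.2 k y)) (gch.2 k _).
  by move=> m; rewrite /= Gaug gaug.
- exact: hcob_map.
apply: (@homotopic_hcob _ _ E' E (fun k => g k \o horseshoe_i1 k)) => //.
  split=> [k m y Gy|k y].
    exact: (gch.1 k m _ (horseshoe_i1_chain.1 k m _ Gy)).
  exact: etrans (congr1 (g k.+1) (horseshoe_i1_chain.2 k y)) (gch.2 k _).
by move=> m; rewrite faug /= -gaug; congr (g _ _); exact: horseshoe_i1_aug.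
Qed.

(** If (x, 0) is the boundary of (y1, y2), then y2 is a cocycle of index i - 1, hence y2 = d w for
    some torsion w, and x is the boundary of y1 - delta w. For i = 1 one has y2 = 0, and for i = 0
    the inclusion is injective. *)
Lemma horseshoe_coh_inj i n x :
  (if i is k.+1 then coh_vanish E'' k n else True) ->
  hcocycles E' i n x -> hcoboundaries E i n (f i x) -> hcoboundaries E' i n x.
Proof.
move=> van Zx Bfx.
have [G [Gch Gaug]] := @chain_lift_res _ _ E horseshoe idfun (fun n x Gx => Gx).
have : hcoboundaries horseshoe i n (horseshoe_i1 i x).
  rewrite -[horseshoe_i1 i x](subrK (G i (f i x))); apply: hcobD; last first.
    exact: hcob_map.
  apply: (@homotopic_hcob _ _ E' horseshoe horseshoe_i1 horseshoe_i1_chain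
    (fun k => G k \o f k)) => //.
    split=> [k m y Gy|k y]; first exact: (Gch.1 k m _ (fch.1 k m _ Gy)).
    exact: etrans (congr1 (G k.+1) (fch.2 k y)) (Gch.2 k _).
  by move=> m; rewrite /= faug Gaug; exact: horseshoe_i1_aug.
case: i van x {Bfx} Zx => [|i] van x Zx; first by move=> [].
move=> [[y1 y2] [Ty [Gy1 Gy2] [y1E /eqP]]]; rewrite oppr_eq0 => /eqP dy2.
have By2 : hcoboundaries E'' i n y2.
  by apply: van; split=> //; exact: (torsion_snd Ty).
have Ty1 := torsion_fst Ty; rewrite /= in y1E Gy1 Gy2 Ty1; clear Zx van Ty.
case: i y1 y2 x y1E dy2 By2 Ty1 Gy1 Gy2 => [|i] y1 y2 x y1E dy2 By2 Ty1 Gy1 Gy2.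
  by exists y1; split=> //; rewrite -y1E By2 linear0 subr0.
have [w [Tw Gw dw]] := By2; exists (y1 - delta i w); split.
- by apply: torsionB => //; exact: torsion_map.
- by apply: grcB => //; exact: dh.
by rewrite linearB -deltaS dw.
Qed.

End Horseshoe.

(** Injectivity extends the augmentation of M' to h on M. Then d h vanishes on M' and factors
    through M'' as v, and [delta] is a lift of v along the resolution of M''. *)
Lemma horseshoe_data : exists (h : {linear M -> E' 0%N})
    (delta : forall k, {linear E'' k -> E' k.+1}),
  [/\ homogeneous_map h, forall k, homogeneous_map (delta k),
      forall y, h (u y) = res_aug E' y,
      forall m, delta 0%N (res_aug E'' (p m)) = res_d E' 0%N (h m)
    & forall k x, delta k.+1 (res_d E'' k x) = res_d E' k.+1 (delta k x)].
Proof.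
have [h hh hE] := res_inj uh (@res_aug_homog _ _ _ E') uinj.
have [||v vh vE] := @gr_injective_extendT _ _ Rgr _ _ _ p (res_d E' 0%N \o h)
  (@res_inj _ _ _ E' 1%N) ph.
- by move=> n x Gx; apply: res_d_homog; exact: hh.
- by move=> x /up0[y <-] /=; rewrite hE res_d_aug.
have [|||||delta [dh d0 dS]] := @chain_lift _ _ Rgr _ E'' (fun k => E' k.+1)
  (fun k => res_d E' k.+1) v.
- by move=> k; exact: res_inj.
- by move=> k; exact: res_d_homog.
- by move=> k x; exact: res_dd.
- exact: vh.
- by move=> m; have [x <-] := psurj m; rewrite vE /= res_dd.
by exists h, delta; split=> // m; rewrite d0 vE.
Qed.

Variable f : forall k, {linear E' k -> E k}.
Hypotheses (fch : chain_map f)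
  (faug : forall m, f 0%N (res_aug E' m) = res_aug E (u m)).

Lemma coh_surj i n z : coh_vanish E'' i n -> hcocycles E i n z ->
  exists x, hcocycles E' i n x /\ hcoboundaries E i n (z - f i x).
Proof.
have [h [delta [hh dh hu d0 dS]]] := horseshoe_data.
exact: (horseshoe_coh_surj hh dh hu d0 dS fch faug).
Qed.

Lemma coh_inj i n x :
  (if i is k.+1 then coh_vanish E'' k n else True) ->
  hcocycles E' i n x -> hcoboundaries E i n (f i x) -> hcoboundaries E' i n x.
Proof.
have [h [delta [hh dh hu d0 dS]]] := horseshoe_data.
exact: (horseshoe_coh_inj hh dh hu d0 dS fch faug).
Qed.

End Exact.

Lemma coh_vanish_ext M' M M'' (u : {linear M' -> M}) (p : {linear M -> M''})
    (E' : gr_inj_resolution M') (E : gr_inj_resolution M)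
    (E'' : gr_inj_resolution M'') i n :
  homogeneous_map u -> homogeneous_map p -> injective u ->
  (forall y, exists x, p x = y) -> (forall x, p x = 0 <-> exists y, u y = x) ->
  coh_vanish E' i n -> coh_vanish E'' i n -> coh_vanish E i n.
Proof.
move=> uh ph uinj psurj up0 van' van'' z Zz.
have [f [fch faug]] := chain_lift_res E' E uh.
have [x [Zx Bx]] := coh_surj uh ph uinj psurj up0 fch faug van'' Zz.
rewrite -(subrK (f i x) z); apply: hcobD => //.
by apply: hcob_map => //; exact: van'.
Qed.

Lemma coh_vanish_degree M (E : gr_inj_resolution M) s :
  (forall n (x : M), s < n -> grc n x -> x = 0) ->
  forall i n, s < n -> coh_vanish E i n.
Proof.
move=> M0.
have [|||||||h [hh h0 hS]] := @chain_homotopy _ _ Rgr _ E [set n | s < n] E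
  (res_d E) (fun k => idfun).
- by move=> n l /= sn; rewrite (lt_le_trans sn) // lerDr.
- by move=> k; exact: res_inj.
- by move=> k; exact: res_d_homog.
- by move=> k x; exact: res_dd.
- by move=> k n x.
- by move=> k x.
- by move=> n m sn Gm /=; rewrite (M0 n m) // linear0.
case=> [|i] n sn z [Tz Gz dz].
  by have := h0 n z sn Gz; rewrite dz linear0 => /esym.
have := hS i n z sn Gz; rewrite dz linear0 => /esym/eqP.
rewrite subr_eq0 => /eqP /= zE; exists (h i z).
by split; [exact: torsion_map|exact: hh|rewrite -zE].
Qed.

(** Multiplication by a and the zero map both lift the zero map of M, hence are homotopic. *)
Lemma annihilator_hcob M (E : gr_inj_resolution M) a i n z :
  Rg 0%N a -> (forall m : M, a *: m = 0) -> hcocycles E i n z ->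
  hcoboundaries E i n (a *: z).
Proof.
move=> Ra aM Zz.
have aE : chain_map (fun k => GRing.scale a : {linear E k -> E k}).
  split=> [k m x Gx|k x] /=; first exact: grc_scale0.
  by rewrite linearZ.
have zE : chain_map (fun k => \0 : {linear E k -> E k}).
  by split=> [k m x Gx|k x] /=; [exact: grc0|rewrite linear0].
have := homotopic_hcob aE zE _ Zz; rewrite /= subr0; apply.
by move=> m; rewrite -linearZ aM linear0.
Qed.

End Cohomology.

Arguments hcocycles {R Rg} I J {M} E i n _.
Arguments hcoboundaries {R Rg} I J {M} E i n _.

(** * Torsion submodules are graded *)

Section Ideals.
Variable R : comNzRingType.
Implicit Types I J C : set R.

Lemma ideal0 I : ideal_of setT I -> I 0. Proof. by case. Qed.

Lemma idealM I c a : ideal_of setT I -> I a -> I (c * a).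
Proof. by case=> _ _ _; apply. Qed.

Lemma idealMr I c a : ideal_of setT I -> I a -> I (a * c).
Proof. by move=> idI Ia; rewrite mulrC; exact: idealM. Qed.

Lemma idealD I a b : ideal_of setT I -> I a -> I b -> I (a + b).
Proof. by case=> _ _ + _ => H; exact: H. Qed.

Lemma ideal_sum I (T : Type) (r : seq T) (F : T -> R) : ideal_of setT I ->
  (forall i, I (F i)) -> I (\sum_(i <- r) F i).
Proof.
move=> idI IF; elim/big_rec: _ => [|i x _ Ix]; first exact: ideal0.
exact: idealD.
Qed.

Lemma radicalD C a b : ideal_of setT C ->
  (exists k, C (a ^+ k)) -> (exists k, C (b ^+ k)) -> exists k, C ((a + b) ^+ k).
Proof.
move=> idC [k Ck] [l Cl]; exists (k + l)%N; rewrite exprDn.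
apply: ideal_sum => // i; rewrite -mulr_natr; apply: idealMr => //.
have [lei|ltk] := leqP l i.
  by apply: idealM => //; rewrite -(subnK lei) exprD; exact: idealM.
apply: idealMr => //; have lek : (k <= k + l - i)%N by rewrite leq_subRL; lia.
by rewrite -(subnK lek) exprD; exact: idealM.
Qed.

Lemma lspan_cons_ideal (h : R) (s : seq R) x :
  lspan setT ([set` h :: s] : set R^o) x ->
  exists c g, lspan setT ([set` s] : set R^o) g /\ x = c * h + g.
Proof.
move: x; apply: lspan_ind => [|x y [c [g [Sg ->]]] [c' [g' [Sg' ->]]]|c x /=].
- by exists 0, 0; split; [exact: lspan0|rewrite mul0r addr0].
- exists (c + c'), (g + g'); split; first exact: lspanD.
  by rewrite mulrDl addrACA.
rewrite inE => /orP[/eqP->|xs].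
  by exists c, 0; split; [exact: lspan0|rewrite addr0].
exists 0, (c * x); split; last by rewrite mul0r add0r.
by apply: (@lspanZ R R^o); exact: lspan_mem.
Qed.

(** Generators are added one by one. If N-fold products from the ideal of [s] lie in C, then N-fold
    products from the ideal of [h :: s] are multiples of h modulo C, so products of N K factors are
    multiples of h^K, which is in C. *)
Lemma radical_power C (s : seq R) : ideal_of setT C ->
  (forall x, x \in s -> exists k, C (x ^+ k)) ->
  exists N, forall f : nat -> R,
    (forall k, lspan setT ([set` s] : set R^o) (f k)) -> C (\prod_(k < N) f k).
Proof.
move=> idC; elim: s => [|h s IH] rad.
  exists 1%N => f Sf; have [p [c [a [_ a0 fE]]]] := Sf 0%N.
  rewrite big_ord1 fE big1; first exact: ideal0.
  by move=> i; have := a0 i.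
have [|N HN] := IH; first by move=> x xs; apply: rad; rewrite inE xs orbT.
have [K CK] := rad h (mem_head _ _).
have block (f : nat -> R) : (forall k : nat, lspan setT ([set` h :: s] : set R^o) (f k)) ->
    exists c g, C g /\ \prod_(k < N) f k = c * h + g.
  move=> Sf.
  have /choice[c /choice[g cgE]] : forall k : nat, exists c g,
      lspan setT ([set` s] : set R^o) g /\ f k = c * h + g.
    by move=> k; exact: lspan_cons_ideal.
  have : exists c', \prod_(k < N) f k = c' * h + \prod_(k < N) g k.
    elim/big_rec2: _ => [|k x y _ [c' ->]]; first by exists 0; rewrite mul0r add0r.
    have [_ ->] := cgE k; exists (c k * (c' * h + x) + g k * c').
    by rewrite !mulrDr !mulrDl; ring.
  move=> [c' ->]; exists c', (\prod_(k < N) g k); split=> //.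
  by apply: (HN g) => k; case: (cgE k).
exists (N * K)%N => f Sf.
suff H M : exists c g, C g /\ \prod_(k < N * M) f k = c * h ^+ M + g.
  have [c [g [Cg ->]]] := H K.
  by apply: idealD => //; exact: idealM.
elim: M => [|M [c [g [Cg E]]]].
  by exists 1, 0; split; [exact: ideal0|rewrite muln0 big_ord0 expr0 mulr1 addr0].
rewrite mulnS addnC big_split_ord /= E.
have [c' [g' [Cg' ->]]] := block (fun k => f (N * M + k)%N) (fun k => Sf _).
exists (c * c'), (c * h ^+ M * g' + g * (c' * h) + g * g'); split.
  by do 2?apply: idealD => //; do ?[exact: idealM|exact: idealMr].
by rewrite exprS; ring.
Qed.

Lemma ideal_prod_congr J (T : Type) (r : seq T) (F G : T -> R) :
  ideal_of setT J -> (forall i, J (F i - G i)) ->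
  J (\prod_(i <- r) F i - \prod_(i <- r) G i).
Proof.
move=> idJ FG; elim/big_rec2: _ => [|i x y _ Jxy].
  by rewrite subrr; exact: ideal0.
have -> : F i * y - G i * x = F i * (y - x) + (F i - G i) * x by ring.
by apply: idealD => //; [exact: idealM|exact: idealMr].
Qed.

Lemma ideal_det_congr J p (A B : 'M[R]_p) :
  ideal_of setT J -> (forall i j, J (A i j - B i j)) -> J (\det A - \det B).
Proof.
move=> idJ AB; rewrite /determinant -sumrB; apply: ideal_sum => // s.
by rewrite -mulrBr; apply: idealM => //; exact: ideal_prod_congr.
Qed.

(** This is Ann(x) + J; torsion means that it contains a power of I. *)
Definition colon (V : lmodType R) J (x : V) : set R :=
  [set a | exists2 b, J b & a *: x = b *: x].

Lemma colon_ideal (V : lmodType R) J (x : V) :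
  ideal_of setT J -> ideal_of setT (colon J x).
Proof.
move=> idJ; split=> // [|a b [a' Ja aE] [b' Jb bE]|c a _ [a' Ja aE]].
- by exists 0 => //; exact: ideal0.
- by exists (a' + b'); [exact: idealD|rewrite !scalerDl aE bE].
- by exists (c * a'); [exact: idealM|rewrite -!scalerA aE].
Qed.

(** Cayley-Hamilton: the determinant of a Id - B kills every y_j by the adjugate identity, and it is
    congruent to a^p modulo J. *)
Lemma colon_det (V : lmodType R) J p (y : 'I_p -> V) a (B : 'M[R]_p) :
  ideal_of setT J -> (forall i j, J (B i j)) ->
  (forall j, a *: y j = \sum_k B j k *: y k) ->
  forall j, colon J (y j) (a ^+ p).
Proof.
move=> idJ JB aE j; pose A := a%:M - B.
have Ay l : \sum_k A l k *: y k = 0.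
  under eq_bigr do rewrite !mxE scalerBl.
  rewrite sumrB -aE (bigD1 l) //= eqxx mulr1n big1 ?addr0 ?subrr // => k nk.
  by rewrite eq_sym (negPf nk) mulr0n scale0r.
have dA : \det A *: y j = 0.
  have <- : \sum_l (\adj A) j l *: (\sum_k A l k *: y k) = \det A *: y j.
    under eq_bigr do rewrite scaler_sumr.
    rewrite exchange_big (bigD1 j) //= [X in _ + X]big1 ?addr0.
      under eq_bigr do rewrite scalerA; rewrite -scaler_suml.
      have := congr1 (fun M : 'M_p => M j j) (mul_adj_mx A).
      by rewrite !mxE eqxx mulr1n => ->.
    move=> k nk; under eq_bigr do rewrite scalerA; rewrite -scaler_suml.
    have := congr1 (fun M : 'M_p => M j k) (mul_adj_mx A).
    by rewrite !mxE eq_sym (negPf nk) mulr0n => ->; rewrite scale0r.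
  by rewrite big1 // => l _; rewrite Ay scaler0.
exists (a ^+ p - \det A); last by rewrite scalerBl dA subr0.
rewrite -det_scalar; apply: ideal_det_congr => // k l.
by rewrite !mxE opprB addrCA subrr addr0.
Qed.

Lemma torsion_prodP I J (V : lmodType R) (x : V) :
  ideal_of setT I -> ideal_of setT J ->
  torsion I J V x <-> exists N, forall f : nat -> R, (forall k, I (f k)) ->
    colon J x (\prod_(k < N) f k).
Proof.
move=> idI idJ; split=> [[N H]|[N H]]; exists N.
  move=> f If; apply: (H N (leqnn N)); apply: lspan_mem.
  by exists (fun k => f k).
move=> n Nn a; change (ideal_pow setT I n a -> colon J x a).
have idC := colon_ideal x idJ.
move=> [p [c [g [_ gI ->]]]]; apply: ideal_sum => // k; apply: idealM => //.
have [f If ->] := gI k.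
(* Extension by 0 keeps all values in I. *)
pose f' l := oapp f 0 (insub l).
have -> : \prod_(k0 < n) f k0 = \prod_(0 <= l < n) f' l.
  by rewrite big_mkord; apply: eq_bigr => l _; rewrite /f' valK.
rewrite (big_cat_nat _ Nn) //= big_mkord; apply: idealMr => //.
by apply: H => l; rewrite /f'; case: insub => [o|] //=; exact: ideal0.
Qed.

End Ideals.

Section GradedTorsion.
Variables (R : comNzRingType) (Rg : nat -> set R).
Hypothesis Rgr : ring_grading Rg.
Hypothesis Rnoeth : noetherian R.
Variables I J : set R.
Hypotheses (idI : ideal_of setT I) (idJ : ideal_of setT J).
Hypothesis I_homog : forall x, I x ->
  lspan setT ([set h | I h /\ exists l, Rg l h] : set R^o) x.
Hypothesis J_homog : forall l x, J x -> J (rproj Rgr l x).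

(** For h in I homogeneous of degree l, torsion gives h^N x = b x with b in J. In each degree this
    reads h^N x_j = sum_k b_(jk) x_k, where b_(jk) is a component of b, hence in J; so [colon_det]
    puts a power of h in the colon ideal of each x_j. Sums of such h, and then finite generation of
    I, give a uniform power of I. *)
Lemma torsion_gproj (M : grmod Rg) n (x : M) :
  torsion I J M x -> torsion I J M (gproj n x).
Proof.
move=> Tx; set s := dsupp (grc_sum M) x.
have [ns|ns] := boolP (n \in s); last first.
  by rewrite /gproj dproj_out //; exact: torsion0.
pose y (j : 'I_(size s)) := gproj (tnth (in_tuple s) j) x.
have idx : (index n s < size s)%N by rewrite index_mem.
have nE : gproj n x = y (Ordinal idx) by rewrite /y (tnth_nth 0) nth_index.
have xE : x = \sum_j y j.
  by rewrite {1}(dproj_sum (grc_sum M) x) (big_tnth _ _ s).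
rewrite nE; apply/torsion_prodP => //.
have idC := colon_ideal (y (Ordinal idx)) idJ.
have rad a : I a -> exists k, colon J (y (Ordinal idx)) (a ^+ k).
  move=> /I_homog; move: a; apply: (@lspan_ind R R^o) => [|a b Ha Hb|c h [If [l Rf]]].
  - by exists 1%N; rewrite expr1; exact: ideal0.
  - exact: radicalD.
  suff [k Ck] : exists k, colon J (y (Ordinal idx)) (h ^+ k).
    by exists k; rewrite exprMn; exact: idealM.
  move/(torsion_prodP _ idI idJ): Tx => [N /(_ (fun=> h) (fun=> If))].
  rewrite prodr_const card_ord => -[b Jb bE].
  (* N comes from the torsion of x, and [size s] is the order of the matrix. *)
  exists (N * size s)%N; rewrite exprM.
  pose e j := tnth (in_tuple s) j.
  apply: (colon_det (B := \matrix_(j, k) rprojz Rgr ((l * N)%N%:Z + e j - e k) b)).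
  - exact: idJ.
  - move=> j k; rewrite mxE; case: (_ - _) => [q|q] /=; first exact: J_homog.
    exact: ideal0.
  move=> j; rewrite /y -(gproj_scale_homog _ _ (RgX Rgr N Rf)).
  rewrite bE {1}xE scaler_sumr gproj_sumr; apply: eq_bigr => k _.
  by rewrite mxE (gproj_scale Rgr _ _ (dproj_mem (grc_sum M) (e k) x)).
have [g IE] := Rnoeth idI.
have [|N HN] := @radical_power _ _ g idC.
  by move=> z zg; apply: rad; rewrite IE; exact: lspan_mem.
by exists N => f If; apply: HN => k; rewrite -IE.
Qed.

(** A homogeneous coboundary d y is also the image of the component of y in its degree, which is
    again torsion by [torsion_gproj]. *)
Lemma loc_cohomology0P (M : grmod Rg) (E : gr_inj_resolution M) i n :
  loc_cohomology I J E i n = [set 0] <-> coh_vanish I J E i n.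
Proof.
have pi0 (x : E i) : quotmod_pi (@coboundaries _ _ I J M E i) x = 0 <->
    @coboundaries _ _ I J M E i x.
  split=> [/quotmod_pi_eq0|]; last by move=> Bx; apply/quotmod_pi_eq0/lspan_mem.
  by rewrite lspan_submod //; exact: coboundaries_submod.
split=> [H0 z [Tz Gz dz]|van].
  have : loc_cohomology I J E i n (quotmod_pi (@coboundaries _ _ I J M E i) z).
    by exists z.
  rewrite H0 => /pi0; case: i z Tz Gz dz { pi0 H0} => [|i] z Tz Gz dz //= [y Ty dy].
  exists (gproj n y); split; [exact: torsion_gproj|exact: dproj_mem|].
  rewrite homog_gproj; last exact: res_d_homog.
  by rewrite dy /gproj dproj_id.
apply/seteqP; split=> [q [z [[Tz dz] Gz] <-]|q ->] /=.
  apply/pi0; have : hcoboundaries I J E i n z by apply: van.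
  by case: i z { pi0 van Tz dz Gz q} => [|i] z //= [y [Ty _ dy]]; exists y.
exists 0; last exact: raddf0.
by split; [split; [exact: torsion0|exact: linear0]|exact: grc0].
Qed.

End GradedTorsion.

(** * Enough graded injectives *)

Section Divisible.
Variable D : zmodType.
Hypothesis Ddiv : forall (k : nat) (d : D), exists d', d' *+ k.+1 = d.

(* G is the graph of a homomorphism from a subgroup of B to D. *)
Definition partial_hom (B : zmodType) (G : set (B * D)) :=
  (forall p q, G p -> G q -> G (p - q)) /\ (forall d, G (0, d) -> d = 0).

Section PartialHom.
Variables (B : zmodType) (G : set (B * D)).
Hypothesis Gh : partial_hom G.

Lemma partial_homD p q : G p -> G q -> G (p + q).
Proof.
case: Gh => GB _ Gp Gq; have -> : p + q = p - (q - q - q) by rewrite subrr sub0r opprK.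
by apply: (GB) => //; apply: (GB) => //; exact: GB.
Qed.

Lemma partial_hom_mulz p k : G p -> G (p *~ k).
Proof.
move=> Gp; have H n : G (p *+ n).
  elim: n => [|n IH]; first by rewrite mulr0n -(subrr p); case: Gh => + _; apply.
  by rewrite mulrS; exact: partial_homD.
case: k => n; first exact: H.
by rewrite NegzE mulrNz -sub0r; case: Gh => + _; apply; [exact: (H 0%N)|exact: (H n.+1)].
Qed.

(** The integers k with k b in the domain form a subgroup. If its least positive element is k0 + 1,
    divide the value at (k0 + 1) b by k0 + 1; without positive elements, 0 will do. *)
Lemma partial_hom_value b :
  exists d', forall k d, G (b *~ k, d) -> d = d' *~ k.
Proof.
have [GB G0] := Gh; pose P k := `[< exists d, G (b *+ k.+1, d) >].
have [[k0 Pk0]|nP] := pselect (exists k, P k); last first.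
  exists 0 => -[[|k]|k] d Gd; rewrite mul0rz.
  - exact: G0.
  - by case: nP; exists k; apply/asboolP; exists d.
  case: nP; exists k; apply/asboolP; exists (- d).
  have := partial_hom_mulz (-1) Gd; rewrite mulrN1z.
  by rewrite NegzE mulrNz -[- _]/(- _, - _) /= opprK.
have ex : exists k, P k by exists k0.
case: (ex_minnP ex) => {k0 Pk0} k0 /asboolP[d0 Gd0] kmin.
have [d' d'E] := Ddiv k0 d0; exists d' => k d Gd.
pose q := (k %/ k0.+1%:Z)%Z; pose r := (k %% k0.+1%:Z)%Z.
have kE : k = q * k0.+1%:Z + r by exact: divz_eq.
have Gr : G (b *~ r, d - d0 *~ q).
  have := GB _ _ Gd (partial_hom_mulz q Gd0).
  have -> // : (b *~ k, d) - (b *+ k0.+1, d0) *~ q = (b *~ r, d - d0 *~ q).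
  have mulzE (V W : zmodType) (v : V) (w : W) z :
      (v, w) *~ z = (v *~ z, w *~ z).
    rewrite [LHS]surjective_pairing.
    by rewrite (raddfMz (@fst V W)) (raddfMz (@snd V W)).
  rewrite mulzE; congr pair => /=.
  by rewrite {1}kE mulrzDr pmulrn -mulrzA (mulrC k0.+1%:Z) addrAC subrr add0r.
have r0 : r = 0.
  have r_ge0 : 0 <= r by exact: modz_ge0.
  have r_lt : r < k0.+1%:Z by exact: ltz_pmod.
  case: r {kE} r_ge0 r_lt Gr => // -[//|r] _ r_lt Gr.
  have /kmin : P r by apply/asboolP; exists (d - d0 *~ q).
  by move: r_lt; lia.
move: Gr; rewrite r0 mulr0z => /G0/eqP; rewrite subr_eq0 => /eqP->.
by rewrite kE r0 addr0 -d'E pmulrn -mulrzA (mulrC k0.+1%:Z).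
Qed.

End PartialHom.

Lemma partial_hom_extend (B : zmodType) (G0 : set (B * D)) :
  G0 !=set0 -> partial_hom G0 ->
  exists2 g : B -> D, zmod_morphism g & forall p, G0 p -> g p.1 = p.2.
Proof.
move=> G0n G0h.
(* The guard admits the empty set, which is the union of the empty chain. The maximal element is
   nonempty, since otherwise [G0] would be larger. *)
pose P (X : set (B * D)) := X !=set0 -> G0 `<=` X /\ partial_hom X.
have [A [PA maxA]] : exists A, P A /\ forall X, A `<` X -> ~ P X.
  apply: Zorn_bigcup => F FP Ftot [p [X FX Xp]].
  have XP Y q : F Y -> Y q -> G0 `<=` Y /\ partial_hom Y.
    by move=> FY Yq; apply: (FP Y FY); exists q.
  split; first by move=> q G0q; exists X => //; apply: (XP X p FX Xp).1.
  split=> [q r [Y FY Yq] [Z FZ Zr]|d [Y FY Yd]].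
    have [YZ|ZY] := Ftot Y Z FY FZ.
      by exists Z => //; apply: (XP Z r FZ Zr).2.1 => //; exact: YZ.
    by exists Y => //; apply: (XP Y q FY Yq).2.1 => //; exact: ZY.
  exact: (XP Y _ FY Yd).2.2.
have [q0 G0q0] := G0n.
have [q1 Aq1] : A !=set0.
  apply: contrapT => An; apply: (maxA G0); last by move=> _; split.
  split=> [q Aq|/(_ q0 G0q0) Aq0]; first by case: An; exists q.
  by apply: An; exists q0.
have [G0A Ah] : G0 `<=` A /\ partial_hom A by apply: PA; exists q1.
have [AB A0] := Ah.
have total b : exists d, A (b, d).
  have [d' d'E] := partial_hom_value Ah b.
  (* The graph of the extension to the subgroup generated by the domain and b, with b sent to d'. *)
  pose A' : set (B * D) := [set q | exists k, A (q - (b, d') *~ k)].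
  have AA' : A `<=` A' by move=> q Aq; exists 0; rewrite mulr0z subr0.
  have A'h : partial_hom A'.
    split=> [q r [k Ak] [l Al]|d [k]].
      exists (k - l); rewrite mulrzBr.
      have -> : q - r - ((b, d') *~ k - (b, d') *~ l) =
          q - (b, d') *~ k - (r - (b, d') *~ l).
        by rewrite !opprB addrACA [- r - _]addrC addrACA.
      exact: AB.
    have -> : (0, d) - (b, d') *~ k = (b *~ (- k), d - d' *~ k).
      rewrite [LHS]surjective_pairing /= (raddfMz (@fst B D)).
      by rewrite (raddfMz (@snd B D)) sub0r mulrNz.
    by move=> /d'E /eqP; rewrite mulrNz subr_eq addNr => /eqP.
  apply: contrapT => nb; apply: (maxA A'); last first.
    by move=> _; split=> //; apply: subset_trans AA'.
  split=> // /(_ (b, d')) H; apply: nb; exists d'; apply: H.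
  exists 1; rewrite mulr1z subrr; case: G0n => q G0q.
  by rewrite -(subrr q); apply: AB; exact: G0A.
have /choice[g gE] := total.
have gu b d : A (b, d) -> d = g b.
  move=> Ad; apply/eqP; rewrite -subr_eq0; apply/eqP/A0.
  by have := AB _ _ Ad (gE b); rewrite -[_ - _]/(_, _) /= subrr.
exists g => [x y|[b d] Gp]; first by apply/esym/gu; exact: (AB _ _ (gE x) (gE y)).
by apply/esym/gu; exact: G0A.
Qed.

Lemma divisible_extend (A B : zmodType) (u : A -> B) (f : A -> D) :
  zmod_morphism u -> zmod_morphism f -> injective u ->
  exists2 g : B -> D, zmod_morphism g & forall x, g (u x) = f x.
Proof.
move=> ua fa uI.
have u0 : u 0 = 0 by have := ua 0 0; rewrite !subrr.
have f0 : f 0 = 0 by have := fa 0 0; rewrite !subrr.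
pose G : set (B * D) := [set p | exists x, p = (u x, f x)].
have [||g ga gE] := @partial_hom_extend B G.
- by exists (u 0, f 0); exists 0.
- split=> [_ _ [x ->] [y ->]|d [x [/esym ux ->]]].
    by exists (x - y); rewrite ua fa.
  by rewrite (uI x 0) // u0.
by exists g => // x; exact: (gE (u x, f x) (ex_intro _ x erefl)).
Qed.

(** Send m to a nonzero d killed by the order of m, or to any nonzero d if the order is infinite,
    then extend from the subgroup generated by m. The order of a nonzero m is at least 2, whence
    [k.+2]. *)
Lemma separating_character (M : zmodType) (m : M) :
  (forall k, exists2 d : D, d != 0 & d *+ k.+2 = 0) -> m != 0 ->
  exists2 chi : M -> D, zmod_morphism chi & chi m != 0.
Proof.
move=> Dtor m0.
have [d d0 dE] : exists2 d : D, d != 0 & forall k, m *~ k = 0 -> d *~ k = 0.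
  pose P k := m *+ k.+2 == 0.
  have [[k0 Pk0]|nP] := pselect (exists k, P k); last first.
    have [d d0 _] := Dtor 0%N; exists d => // k mk.
    case: (k =P 0) => [->|/eqP k0]; first by rewrite mulr0z.
    have : m *+ `|k|%N == 0.
      rewrite pmulrn abszE; by case: ger0P => _; rewrite ?mulrNz mk ?oppr0.
    case E : `|k|%N => [|[|l]]; first by move/eqP: E; rewrite absz_eq0 (negPf k0).
      by rewrite mulr1n (negPf m0).
    by move=> ml; case: nP; exists l.
  have ex : exists k, P k by exists k0.
  case: (ex_minnP ex) => {k0 Pk0} k0 /eqP mk0 kmin.
  have [d d0 dk0] := Dtor k0; exists d => // k mk.
  pose q := (k %/ k0.+2%:Z)%Z; pose r := (k %% k0.+2%:Z)%Z.
  have kE : k = k0.+2%:Z * q + r by rewrite mulrC; exact: divz_eq.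
  have mr : m *~ r = 0.
    by move: mk; rewrite kE mulrzDr mulrzA -pmulrn mk0 mul0rz add0r.
  have r0 : r = 0.
    have r_ge0 : 0 <= r by exact: modz_ge0.
    have r_lt : r < k0.+2%:Z by exact: ltz_pmod.
    case: r {kE} r_ge0 r_lt mr => // -[//|[|r]] _ r_lt mr.
      by move: mr; rewrite mulr1z => /eqP; rewrite (negPf m0).
    have /kmin : P r by apply/eqP.
    by move: r_lt; lia.
  by rewrite kE r0 addr0 mulrzA -pmulrn dk0 mul0rz.
pose G : set (M * D) := [set p | exists k, p = (m *~ k, d *~ k)].
have [||chi chia chiE] := @partial_hom_extend M G.
- by exists (m *~ 0, d *~ 0); exists 0.
- split=> [_ _ [x ->] [y ->]|e [k [/esym/dE dk ->]]] //.
  by exists (x - y); rewrite !mulrzBr.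
exists chi => //; rewrite (chiE (m, d)) //.
by exists 1; rewrite !mulr1z.
Qed.

End Divisible.

(** * The group Q/Z *)

Definition rat_mod_int : zmodType := quotmod ([set 1] : set (zmodule rat)).

Section RatModInt.
Let D := rat_mod_int.

Lemma rat_mod_int_pi_eq0 (x : rat) :
  quotmod_pi ([set 1] : set (zmodule rat)) x = 0 <-> exists k : int, x = k%:~R.
Proof.
split=> [/quotmod_pi_eq0|[k ->]]; last first.
  by apply/quotmod_pi_eq0; exact: (@lspanZ int (zmodule rat) _ k 1 (lspan_mem _)).
move: x; apply: (@lspan_ind int (zmodule rat)) => [|x y [k ->] [l ->]|c x ->].
- by exists 0.
- by exists (k + l); rewrite intrD.
- by exists c.
Qed.

Lemma rat_mod_int_divisible k (d : D) : exists d', d' *+ k.+1 = d.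
Proof.
elim/quotmod_ind: d => x.
exists (quotmod_pi ([set 1] : set (zmodule rat)) ((x : rat) / k.+1%:R)).
rewrite -raddfMn; congr quotmod_pi.
by rewrite -[LHS]mulr_natr mulfVK // pnatr_eq0.
Qed.

Lemma rat_mod_int_torsion k : exists2 d : D, d != 0 & d *+ k.+2 = 0.
Proof.
exists (quotmod_pi ([set 1] : set (zmodule rat)) (k.+2%:R^-1 : rat)).
  apply/eqP => /rat_mod_int_pi_eq0[l lE].
  have : (1 : rat) = (l * k.+2%:Z)%:~R.
    by rewrite intrM -lE mulVf // pnatr_eq0.
  move/eqP; rewrite -[1]/(1%:~R) eqr_int => /eqP.
  move/(congr1 absz); rewrite abszM /= => /eqP.
  by rewrite eq_sym muln_eq1 andbF.
rewrite -raddfMn; apply/rat_mod_int_pi_eq0; exists 1.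
by rewrite -[LHS]mulr_natr mulVf // pnatr_eq0.
Qed.

End RatModInt.

(** * The coinduced module Hom_Z(R, W) *)

Section Coinduced.
Variables (R : comNzRingType) (W : zmodType).

Definition coind_pred : {pred (R -> W)} := fun e => `[< zmod_morphism e >].

Fact coind_pred_closed : zmod_closed coind_pred.
Proof.
split=> [|e f /asboolP ea /asboolP fa]; apply/asboolP => x y.
  by rewrite subrr.
rewrite -![(e - f) _]/(e _ - f _) ea fa !opprB addrACA.
by rewrite [RHS]addrACA; congr (_ + _); rewrite addrC.
Qed.

HB.instance Definition _ := GRing.isZmodClosed.Build (R -> W) coind_pred
  coind_pred_closed.

Definition coind : Type := {e : R -> W | coind_pred e}.

HB.instance Definition _ := SubType.on coind.
HB.instance Definition _ := Choice.on coind.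
HB.instance Definition _ := [SubChoice_isSubZmodule of coind by <:].

Lemma coindP (e : coind) : zmod_morphism (val e).
Proof. by case: e => e /= /asboolP. Qed.

Definition coind_of (e : R -> W) (ea : zmod_morphism e) : coind :=
  exist _ e (asboolT ea).

Fact coind_scale_subproof (a : R) (e : coind) :
  zmod_morphism (fun t => val e (t * a)).
Proof. by move=> x y; rewrite mulrBl coindP. Qed.

Definition coind_scale a e : coind := coind_of (coind_scale_subproof a e).

Lemma coind_ext (e f : coind) : (forall t, val e t = val f t) -> e = f.
Proof. by move=> ef; apply: val_inj; apply: funext. Qed.

Lemma coindD (e f : coind) t : val (e + f) t = val e t + val f t.
Proof. by []. Qed.

Fact coind_scaleA a b e : coind_scale a (coind_scale b e) = coind_scale (a * b) e.
Proof. by apply: coind_ext => t /=; rewrite mulrA. Qed.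

Fact coind_scale1 : left_id 1 coind_scale.
Proof. by move=> e; apply: coind_ext => t /=; rewrite mulr1. Qed.

Fact coind_scaleDr : right_distributive coind_scale +%R.
Proof. by move=> a e f; apply: coind_ext. Qed.

Lemma coind_addr (e : coind) s t : val e (s + t) = val e s + val e t.
Proof.
have e0 : val e 0 = 0 by have := coindP e 0 0; rewrite !subrr.
have et : val e (0 - t) = - val e t by rewrite coindP e0 sub0r.
have -> : s + t = s - (0 - t) by rewrite sub0r opprK.
by rewrite coindP et opprK.
Qed.

Fact coind_scaleDl e : {morph coind_scale^~ e : a b / a + b}.
Proof.
by move=> a b; apply: coind_ext => t; rewrite coindD /= mulrDr coind_addr.
Qed.

HB.instance Definition _ := GRing.Zmodule_isLmodule.Build R coind
  coind_scaleA coind_scale1 coind_scaleDr coind_scaleDl.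

Lemma coindZ a (e : coind) t : val (a *: e) t = val e (t * a).
Proof. by []. Qed.

End Coinduced.

Section GradedInjective.
Variables (R : comNzRingType) (Rg : nat -> set R).
Hypothesis Rgr : ring_grading Rg.
Variable X : Type.

Let D := rat_mod_int.
Let W : zmodType := int -> X -> D.
Let V : lmodType R := coind R W.

(* A graded piece of Hom(R, prod_(s : int) D^X), the factor of index s being
   placed in degree s. *)
Definition coind_grc (n : int) : set V :=
  [set e | forall j t, Rg j t -> forall s x, s <> j%:Z + n -> val e t s x = 0].

Definition coind_homog : set V := [set e | exists n, coind_grc n e].

Lemma coind_grcB n e f : coind_grc n e -> coind_grc n f -> coind_grc n (e - f).
Proof.
move=> Ge Gf j t Rt s x sn.
change (val e t s x - val f t s x = 0).
by rewrite (Ge j) // (Gf j) // subrr.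
Qed.

Lemma coind_grc0 n : coind_grc n 0.
Proof. by []. Qed.

Lemma coind_grc_scale i n a e : Rg i a -> coind_grc n e ->
  coind_grc (i%:Z + n) (a *: e).
Proof.
move=> Ra Ge j t Rt s x sn; rewrite coindZ; apply: (Ge (j + i)%N).
  exact: RgM.
by rewrite PoszD -addrA.
Qed.

Lemma coind_sum (W' : zmodType) (T : Type) (r : seq T) (F : T -> coind R W') t :
  val (\sum_(i <- r) F i) t = \sum_(i <- r) val (F i) t.
Proof.
elim: r => [|i r IH]; first by rewrite !big_nil.
by rewrite !big_cons coindD IH.
Qed.

Lemma coind_addr_sum (W' : zmodType) (e : coind R W') (T : Type) (r : seq T)
    (F : T -> R) :
  val e (\sum_(i <- r) F i) = \sum_(i <- r) val e (F i).
Proof.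
have e0 : val e 0 = 0 by have := coindP e 0 0; rewrite !subrr.
exact: (big_morph (val e) (coind_addr e) e0).
Qed.

Lemma fct_sum (T : Type) (r : seq T) (F : T -> W) s x :
  (\sum_(i <- r) F i) s x = \sum_(i <- r) F i s x.
Proof.
by elim: r => [|i r IH]; rewrite ?big_nil // !big_cons -IH.
Qed.

(** At a homogeneous t of degree j, the coordinate of index j + n sees only the term of degree n. *)
Lemma coind_grc_indep (s : seq int) (f : int -> V) : uniq s ->
  (forall n, coind_grc n (f n)) -> \sum_(n <- s) f n = 0 ->
  forall n, n \in s -> f n = 0.
Proof.
move=> us Gf f0 n ns; apply: coind_ext => t.
rewrite (dproj_sum (ring_sum Rgr) t) coind_addr_sum big1 // => j _.
have Rj := dproj_mem (ring_sum Rgr) j t; set t' := dproj _ _ _ in Rj *.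
apply/funext => k; apply/funext => x; case: (k =P j%:Z + n) => [->|kn]; last first.
  exact: Gf kn.
have := congr1 (fun e : V => val e t' (j%:Z + n) x) f0.
rewrite coind_sum fct_sum (bigD1_seq n) //= big1 ?addr0 // => n' nn'.
apply: (Gf n' j) => // /addrI nE; by rewrite nE eqxx in nn'.
Qed.

Definition coind_grmod : grmod Rg :=
  span_grmod Rgr coind_grcB coind_grc0 coind_grc_indep coind_grc_scale
    (A := coind_homog) (fun e He => He).

Lemma coind_grmod_sum (T : Type) (r : seq T) (F : T -> coind_grmod) t s x :
  val (spanmod_val (\sum_(i <- r) F i)) t s x =
  \sum_(i <- r) val (spanmod_val (F i)) t s x.
Proof.
have E : spanmod_val (\sum_(i <- r) F i) = \sum_(i <- r) spanmod_val (F i).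
  exact: (@spanmod_val_sum _ _ _ T r F).
by have := congr1 (fun e : V => val e t s x) E; rewrite coind_sum fct_sum.
Qed.

Section CoindMap.
Variables (B : grmod Rg) (theta : int -> X -> B -> D).
Hypothesis theta_add : forall s x, zmod_morphism (theta s x).

Let theta0 s x : theta s x 0 = 0.
Proof. by have := theta_add s x 0 0; rewrite !subrr. Qed.

Let thetaD s x : {morph theta s x : b c / b + c}.
Proof.
move=> b c; have -> : b + c = b - (0 - c) by rewrite sub0r opprK.
by rewrite !theta_add theta0 sub0r opprK.
Qed.

Fact coind_fun_add (b : B) :
  zmod_morphism (fun t : R => (fun s x => theta s x (gproj s (t *: b))) : W).
Proof.
move=> t t'; apply/funext => s; apply/funext => x.
change (theta s x (gproj s ((t - t') *: b)) =
  theta s x (gproj s (t *: b)) - theta s x (gproj s (t' *: b))).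
by rewrite scalerBl gprojB theta_add.
Qed.

Definition coind_fun (b : B) : V := coind_of (coind_fun_add b).

Lemma coind_fun_homog n b : grc n b -> coind_grc n (coind_fun b).
Proof.
move=> Gb j t Rt s x sn /=; rewrite /gproj (@dproj_neq _ _ _ _ (j%:Z + n)) //.
  exact/eqP.
exact: grc_scale.
Qed.

Lemma coind_fun_lin a b b' :
  coind_fun (a *: b + b') = a *: coind_fun b + coind_fun b'.
Proof.
apply: coind_ext => t; rewrite coindD coindZ /=.
apply/funext => s; apply/funext => x.
change (theta s x (gproj s (t *: (a *: b + b'))) =
  theta s x (gproj s ((t * a) *: b)) + theta s x (gproj s (t *: b'))).
by rewrite scalerDr scalerA gprojD thetaD.
Qed.

(** One direction of the adjunction between restriction to Z and coinduction; only the restriction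
    of [theta s x] to the component of degree s matters. *)
Lemma coind_map_exists : exists g : {linear B -> coind_grmod},
  homogeneous_map g /\
  forall b t s x, val (spanmod_val (g b)) t s x = theta s x (gproj s (t *: b)).
Proof.
pose f := linear_pack coind_fun_lin.
have fS b : lspan setT coind_homog (f b).
  rewrite (dproj_sum (grc_sum B) b) linear_sum; apply: lspan_sum => n.
  by apply: lspan_mem; exists n; apply: coind_fun_homog; exact: dproj_mem.
have /choice[g gE] : forall b, exists y : coind_grmod, spanmod_val y = f b.
  by move=> b; exact: spanmod_valK.
have glin a b b' : g (a *: b + b') = a *: g b + g b'.
  by apply: spanmod_val_inj; rewrite linearP !gE linearP.
exists (linear_pack glin); split=> [n b Gb|b t s x]; last first.
  exact: (congr1 (fun e : V => val e t s x) (gE b)).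
by have : coind_grc n (f b) by [exact: coind_fun_homog]; rewrite -(gE b).
Qed.

End CoindMap.

(** The other direction: f is recovered from its values [th] at 1, as f(a)(t) = th(t a). Extending
    each coordinate of [th] along u, by divisibility of Q/Z, extends f. *)
Lemma coind_injective : gr_injective coind_grmod.
Proof.
move=> A B u f uh fh uI.
pose th (a : A) : W := val (spanmod_val (f a)) 1.
have thE a t : val (spanmod_val (f a)) t = th (t *: a).
  have fZ : f (t *: a) = t *: f a by exact: linearZ.
  have := congr1 (fun e : coind_grmod => val (spanmod_val e) 1) fZ.
  by rewrite spanmod_valZ coindZ mul1r => <-.
have thB s x : zmod_morphism (fun a => th a s x).
  move=> a b; have fB : f (a - b) = f a - f b by exact: raddfB.
  have := congr1 (fun e : coind_grmod => val (spanmod_val e) 1 s x) fB.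
  by rewrite spanmod_valB.
(* As f is homogeneous, the coordinate s at 1 ignores the components of a in degrees other than
   s. *)
have th_homog a s x : th a s x = th (gproj s a) s x.
  rewrite {1}(dproj_sum (grc_sum A) a) /th.
  have fS : f (\sum_(n <- dsupp (grc_sum A) a) dproj (grc_sum A) n a) =
      \sum_(n <- dsupp (grc_sum A) a) f (dproj (grc_sum A) n a).
    exact: linear_sum.
  have := congr1 (fun e : coind_grmod => val (spanmod_val e) 1 s x) fS.
  rewrite /= (coind_grmod_sum _ (fun n => f (dproj (grc_sum A) n a))) => ->.
  have E n : val (spanmod_val (f (dproj (grc_sum A) n a))) 1 s x =
      if n == s then th (gproj s a) s x else 0.
    case: eqP => [->//|/eqP ns].
    have := fh n _ (dproj_mem (grc_sum A) n a).
    move=> /(_ 0%N 1 (Rg1 Rgr) s x); apply; rewrite add0r => sn.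
    by rewrite sn eqxx in ns.
  under eq_bigr do rewrite E.
  case: (boolP (s \in dsupp (grc_sum A) a)) => ss.
    rewrite (bigD1_seq s) //=; last by case: (dproj_decomposition (grc_sum A) a).
    by rewrite eqxx big1 ?addr0 // => n /negPf->.
  rewrite /gproj dproj_out // big1_seq => [|n /andP[_ ns]].
    by have := thB s x 0 0; rewrite !subrr.
  by case: eqP => // nE; rewrite -nE ns in ss.
have /choice[g0 g0P] : forall s, exists g : X -> B -> D,
    forall x, zmod_morphism (g x) /\ forall a, g x (u a) = th a s x.
  move=> s; suff /choice[g gP] : forall x, exists g : B -> D, zmod_morphism g /\
    forall a, g (u a) = th a s x by exists g.
  move=> x; have [g ga gE] := divisible_extend rat_mod_int_divisible
    (u := u) (fun a b => raddfB u a b) (thB s x) uI.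
  by exists g.
have [g [gh gE]] := coind_map_exists (fun s x => (g0P s x).1).
exists g => // a; apply: spanmod_val_inj; apply: coind_ext => t.
apply/funext => s; apply/funext => x.
by rewrite gE -linearZ -homog_gproj // (g0P s x).2 -th_homog thE.
Qed.

End GradedInjective.

(** * Existence of graded injective resolutions *)

Section Resolutions.
Variables (R : comNzRingType) (Rg : nat -> set R).
Hypothesis Rgr : ring_grading Rg.

(** The index set X is M itself, with a character for each m that does not vanish at m unless m = 0.
    A nonzero component m_s is detected at t = 1 by the coordinate s and the character of m_s. *)
Lemma enough_injectives (M : grmod Rg) : exists (E : grmod Rg)
    (u : {linear M -> E}), [/\ gr_injective E, homogeneous_map u & injective u].
Proof.
have /choice[chi chiP] : forall m : M, exists chi : M -> rat_mod_int,
    zmod_morphism chi /\ (m != 0 -> chi m != 0).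
  move=> m; have [->|m0] := eqVneq m 0.
    by exists (fun=> 0); split=> // x y; rewrite subrr.
  have [c ca cm] := separating_character rat_mod_int_divisible
    rat_mod_int_torsion m0.
  by exists c.
have [u [uh uE]] := coind_map_exists Rgr (B := M) (X := M)
  (theta := fun _ m => chi m) (fun _ m => (chiP m).1).
exists (coind_grmod Rgr M), u; split=> //; first exact: coind_injective.
suff u0 m : u m = 0 -> m = 0.
  move=> x y uxy; apply/eqP; rewrite -subr_eq0; apply/eqP/u0.
  by rewrite linearB uxy subrr.
move=> um; rewrite (dproj_sum (grc_sum M) m) big1 // => s _.
apply/eqP; apply: contraT => /(chiP _).2; have := uE m 1 s (gproj s m).
rewrite um scale1r /gproj => <-.
have -> : spanmod_val (0 : coind_grmod Rgr M) = 0 by exact: raddf0.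
by rewrite eqxx.
Qed.

Lemma resolution_exists (M : grmod Rg) : exists E : gr_inj_resolution M, True.
Proof.
have emb (N : grmod Rg) : {E : grmod Rg & {u : {linear N -> E} |
    [/\ gr_injective E, homogeneous_map u & injective u]}}.
  by have /cid[E /cid[u uP]] := enough_injectives N; exists E, u.
pose E0 N := projT1 (emb N); pose u0 N := projT1 (projT2 (emb N)).
have E0P N : [/\ gr_injective (E0 N), homogeneous_map (u0 N) & injective (u0 N)].
  exact: projT2 (projT2 (emb N)).
(* [gquot] asks for homogeneous generators; these span the whole image, by [imE]. *)
pose im N : set (E0 N) := [set u0 N x | x in @homog_elements R Rg N].
have im_homog N : im N `<=` @homog_elements R Rg (E0 N).
  by move=> _ [x [n Gx] <-]; exists n; case: (E0P N) => _ + _; apply.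
have imE N x : lspan setT (im N) x <-> range (u0 N) x.
  split.
    move: x; apply: lspan_ind => [|x y [a _ <-] [b _ <-]|c x [a _ <-]].
    - by exists 0 => //; exact: linear0.
    - by exists (a + b) => //; exact: linearD.
    - by exists (c *: a) => //; exact: linearZ.
  move=> [a _ <-]; rewrite (dproj_sum (grc_sum N) a) linear_sum.
  apply: lspan_sum => n; apply: lspan_mem; exists (dproj (grc_sum N) n a) => //.
  by exists n; exact: dproj_mem.
pose next N := gquot Rgr (im_homog N).
pose syz := fix syz k := if k is k'.+1 then next (syz k') else M.
pose d k : {linear E0 (syz k) -> E0 (syz k.+1)} :=
  u0 (syz k.+1) \o gquot_pi Rgr (im_homog (syz k)).
have d0 k x : d k x = 0 <-> range (u0 (syz k)) x.
  rewrite -imE -(gquot_pi_eq0 Rgr (im_homog (syz k))); split=> [|px].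
    rewrite -(linear0 (u0 (syz k.+1))); case: (E0P (syz k.+1)) => _ _.
    by move=> inj /inj.
  by rewrite /d /= px linear0.
unshelve eexists (@GrInjResolution _ _ M (fun k => E0 (syz k)) d (u0 M)
  _ _ _ _ _ _) => //.
- by move=> k; case: (E0P (syz k)).
- move=> k n x Gx; case: (E0P (syz k.+1)) => _ uh _; apply: uh.
  exact: gquot_pi_homog.
- by case: (E0P M).
- by case: (E0P M).
- by apply/seteqP; split=> x /=; rewrite (d0 0%N).
move=> k; apply/seteqP; split=> x /=; rewrite (d0 k.+1).
  by move=> [y _ <-]; exists (gquot_pi Rgr (im_homog (syz k)) y).
move=> [q _ <-]; have [y <-] := gquot_pi_surj (Rgr := Rgr) (hA := im_homog (syz k)) q.
by exists y.
Qed.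

End Resolutions.

(** * Noetherian induction *)

Section Noetherian.
Variable R : comNzRingType.
Hypothesis Rnoeth : noetherian R.

(** Counterexamples would form a strictly increasing chain, whose union is finitely generated and
    thus already contained in one of its terms. *)
Lemma noetherian_ind (P : set R -> Prop) :
  (forall I, ideal_of setT I ->
     (forall I', ideal_of setT I' -> I `<` I' -> P I') -> P I) ->
  forall I, ideal_of setT I -> P I.
Proof.
move=> step I idI; apply: contrapT => nPI.
pose T (_ : nat) := {I : set R | ideal_of setT I /\ ~ P I}.
have nx k (x : T k) : exists y : T k.+1, projT1 x `<` projT1 y.
  case: x => I' [idI' nP] /=; apply: contrapT => H; apply: nP; apply: step => //.
  move=> I'' id'' lt; apply: contrapT => nP''; apply: H.
  by exists (exist _ I'' (conj id'' nP'')).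
have [s [_ _ sS]] := @dependent_sequence T (fun _ _ => True)
  (fun k x y => projT1 x `<` projT1 y) (exist _ I (conj idI nPI)) Logic.I
  (fun k x _ => let: ex_intro y H := nx k x in ex_intro _ y (conj Logic.I H)).
have sid k : ideal_of setT (projT1 (s k)) by case: (s k) => ? [].
have mono k l : (k <= l)%N -> projT1 (s k) `<=` projT1 (s l).
  move=> kl; rewrite -(subnK kl); elim: (l - k)%N => // n IH.
  by apply: subset_trans IH _; exact: (sS _).1.
pose U : set R := [set x | exists k, projT1 (s k) x].
have idU : ideal_of setT U.
  split=> // [|a b [k ka] [l lb]|c a _ [k ka]].
  - by exists 0%N; exact: ideal0.
  - exists (maxn k l); apply: idealD => //.
      by apply: mono ka; exact: leq_maxl.
    by apply: mono lb; exact: leq_maxr.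
  - by exists k; exact: idealM.
have [g UE] := Rnoeth idU.
have [k gk] : exists k, {in g, forall x, projT1 (s k) x}.
  have : forall x, x \in g -> U x by move=> x xg; rewrite UE; exact: lspan_mem.
  elim: g {UE} => [|x g IH] gU; first by exists 0%N.
  have [l gl] : exists l, {in g, forall x, projT1 (s l) x}.
    by apply: IH => y yg; apply: gU; rewrite inE yg orbT.
  have [k kx] := gU x (mem_head _ _).
  exists (maxn k l) => y; rewrite inE => /orP[/eqP->|/gl].
    by apply: mono kx; exact: leq_maxl.
  by apply: mono; exact: leq_maxr.
case: (sS k) => _; apply => x xk.
have : U x by exists k.+1.
rewrite UE; move: x {xk}; apply: (@lspan_ind R R^o) => [|x y|c x /gk].
- exact: (ideal0 (sid k)).
- exact: (idealD (sid k)).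
- exact: (idealM _ (sid k)).
Qed.

End Noetherian.

(** * Reduction of cyclic graded modules *)

Section Devissage.
Variables (R : comNzRingType) (Rg : nat -> set R).
Hypothesis Rgr : ring_grading Rg.
Hypothesis Rnoeth : noetherian R.

Definition gr_cyclic (M : grmod Rg) (x : M) :=
  (exists n, grc n x) /\ forall m, exists r, m = r *: x.

Definition annihilator (V : lmodType R) (x : V) : set R :=
  [set r | r *: x = 0].

Lemma annihilator_ideal (V : lmodType R) (x : V) :
  ideal_of setT (annihilator x).
Proof.
split=> // [|a b|c a _] /=; rewrite /annihilator /=.
- exact: scale0r.
- by move=> a0 b0; rewrite scalerDl a0 b0 addr0.
- by move=> a0; rewrite -scalerA a0 scaler0.
Qed.

Lemma lspan1 (V : lmodType R) (x y : V) :
  lspan setT [set x] y <-> exists r, y = r *: x.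
Proof.
split; last by move=> [r ->]; apply: lspanZ; exact: lspan_mem.
move: y; apply: lspan_ind => [|y z [r ->] [r' ->]|c y ->].
- by exists 0; rewrite scale0r.
- by exists (r + r'); rewrite scalerDl.
- by exists c.
Qed.

Section Cyclic.
Variables (M : grmod Rg) (x : M) (A : set M).
Hypothesis hA : A `<=` @homog_elements R Rg M.
Hypothesis xM : gr_cyclic x.

Lemma gquot_cyclic : gr_cyclic (gquot_pi Rgr hA x).
Proof.
case: xM => [[n Gx] gen]; split; first by exists n; exact: gquot_pi_homog.
move=> q; have [m <-] := gquot_pi_surj (Rgr := Rgr) (hA := hA) q.
by have [r ->] := gen m; exists r; exact: linearZ.
Qed.

End Cyclic.

Lemma homog_set1 (M : grmod Rg) (x : M) n : grc n x ->
  [set x] `<=` @homog_elements R Rg M.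
Proof. by move=> Gx y ->; exists n. Qed.

Lemma gsub1_cyclic (M : grmod Rg) (x : M) (h : [set x] `<=` @homog_elements R Rg M) :
  exists y : gsub Rgr h, gsub_val Rgr h y = x /\ gr_cyclic y.
Proof.
have [y yx] : exists y : gsub Rgr h, spanmod_val y = x.
  by apply: spanmod_valK; exact: lspan_mem.
exists y; split=> //; split.
  by have [n Gx] := h x erefl; exists n; rewrite /grc /= /span_grc /mkset yx.
move=> m; have /lspan1[r mr] := spanmod_valP m.
by exists r; apply: spanmod_val_inj; rewrite mr spanmod_valZ yx.
Qed.

(* Induction on the annihilator of a generator of a cyclic module M = R x: if
   a x <> 0 then either a is M-regular, or both R a x and M / a M have a strictly
   larger annihilator. *)
Lemma cyclic_devissage (S : set R) (Q : grmod Rg -> Prop) :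
  (forall a, S a -> exists l, Rg l a) ->
  (forall (M : grmod Rg) (x : M), gr_cyclic x ->
     (forall a, S a -> a *: x = 0) -> Q M) ->
  (forall (M : grmod Rg) (A : set M) (h : A `<=` @homog_elements R Rg M),
     Q (gsub Rgr h) -> Q (gquot Rgr h) -> Q M) ->
  (forall (M : grmod Rg) (x : M) a (h : [set a *: x] `<=` @homog_elements R Rg M),
     gr_cyclic x -> S a -> (forall m : M, a *: m = 0 -> m = 0) ->
     Q (gquot Rgr h) -> Q M) ->
  forall (M : grmod Rg) (x : M), gr_cyclic x -> Q M.
Proof.
move=> Shom base ext reg M x xM.
pose P I := forall (M : grmod Rg) (x : M), gr_cyclic x -> annihilator x = I -> Q M.
suff /(_ _ (annihilator_ideal x)) H : forall I, ideal_of setT I -> P I.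
  exact: H xM erefl.
apply: (noetherian_ind Rnoeth) => {M x xM} I idI IH M x xM annx.
have [Sx|/existsNP[a /not_implyP[Sa ax]]] := pselect (forall a, S a -> a *: x = 0).
  exact: base xM Sx.
have [[n Gx] gen] := xM; have [l Rl] := Shom a Sa.
have Gax : grc (l%:Z + n) (a *: x) by exact: grc_scale.
have h := homog_set1 Gax.
have Qquot : Q (gquot Rgr h).
  apply: (IH _ (annihilator_ideal _) _ _ _ (gquot_cyclic h xM) erefl).
  split.
    rewrite -annx => r rx; rewrite /annihilator /mkset -linearZ.
    by apply/gquot_pi_eq0; rewrite rx; exact: lspan0.
  move=> /(_ a) H; apply: ax.
  suff : I a by rewrite -annx.
  apply: H; rewrite /annihilator /mkset -linearZ.
  by apply/gquot_pi_eq0; exact: lspan_mem.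
have [areg|/existsNP[m /not_implyP[am m0]]] :=
    pselect (forall m : M, a *: m = 0 -> m = 0).
  exact: reg xM Sa areg Qquot.
apply: (ext _ _ h) Qquot; have [y [yE yM]] := gsub1_cyclic h.
have annE r : r *: y = 0 <-> r *: (a *: x) = 0.
  have vE : gsub_val Rgr h (r *: y) = r *: (a *: x).
    exact: etrans (spanmod_valZ _ _) (congr1 (GRing.scale r) yE).
  split=> [ry|ry]; first by rewrite -vE ry; exact: linear0.
  apply: (@gsub_val_inj _ _ Rgr _ _ h); rewrite vE ry; exact/esym/linear0.
apply: (IH _ (annihilator_ideal _) _ _ _ yM erefl); split.
  rewrite -annx => r rx; apply/annE; rewrite scalerA mulrC -scalerA.
  by rewrite [r *: x]rx scaler0.
(* Since m = r x is nonzero and a m = 0, r kills a x but not x. *)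
have [r mE] := gen m => /(_ r) H; apply: m0; rewrite mE.
suff : I r by rewrite -annx.
by apply/H/annE; rewrite scalerA mulrC -scalerA -mE.
Qed.

End Devissage.

(** * Resolutions of shifted modules *)

Section Shift.
Variables (R : comNzRingType) (Rg : nat -> set R).
Variable c : int.

Lemma gshift_injective (E : grmod Rg) : gr_injective E -> gr_injective (gshift c E).
Proof.
move=> Einj A B u f uh fh uI.
have [||//|g gh gE] := Einj (gshift (- c) A) (gshift (- c) B) u f.
- by move=> n x; exact: uh.
- by move=> n x Gx; have := fh _ x Gx; rewrite /grc /= /gshift_grc subrK.
exists g => // n x Gx; apply: gh.
by rewrite /grc /= /gshift_grc addrK.
Qed.

(** With c = -1, multiplication by an element of R_1 becomes a map M(-1) -> M of degree 0, to which
    the exact sequence applies. *)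
Definition gshift_resolution (M : grmod Rg) (E : gr_inj_resolution M) :
  gr_inj_resolution (gshift c M) :=
  @GrInjResolution R Rg (gshift c M) (fun k => gshift c (E k)) (res_d E)
    (res_aug E) (fun k => gshift_injective (@res_inj _ _ _ E k))
    (fun k n x => @res_d_homog _ _ _ E k (n + c) x)
    (fun n x => @res_aug_homog _ _ _ E (n + c) x)
    (@res_aug_inj _ _ _ E) (@res_exact0 _ _ _ E) (@res_exactS _ _ _ E).

End Shift.

(** * Vanishing in high degrees *)

Section HighDegrees.
Variables (R : comNzRingType) (Rg : nat -> set R) (m0 b0 : set R).
Hypothesis Rnoeth : noetherian R.
Hypothesis Rstd : standard_graded Rg.
Hypothesis m0_ideal : ideal_of (Rg 0%N) m0.
Hypothesis b0_ideal : ideal_of (Rg 0%N) b0.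

Let Rgr : ring_grading Rg. Proof. by case: Rstd. Qed.
Let b := ideal_add (ideal_ext b0) (irrelevant_ideal Rg).
Let m0R := ideal_ext m0.

Lemma ideal_ext_ideal (A : set R) : ideal_of setT (ideal_ext A).
Proof.
split=> // [|x y [p [c [u [Ac _ ->]]]] [q [d [v [Ad _ ->]]]]|a x _ [p [c [u [Ac _ ->]]]]].
- by exists 0%N, (fun=> 0), (fun=> 0); split=> [[]|[]|]; rewrite ?big_ord0.
- exists (p + q)%N, (fun k => match fintype.split k with inl i => c i | inr j => d j end).
  exists (fun k => match fintype.split k with inl i => u i | inr j => v j end).
  split=> // [k|]; first by case: (fintype.split k).
  rewrite big_split_ord; congr (_ + _); apply: eq_bigr => k _.
    by rewrite (unsplitK (inl k)).
  by rewrite (unsplitK (inr k)).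
exists p, c, (fun k => a * u k); split=> //.
by rewrite mulr_sumr; apply: eq_bigr => k _; rewrite /GRing.scale /= mulrCA.
Qed.

Lemma rproj_scale0 l c a : Rg 0%N c -> rproj Rgr l (c * a) = c * rproj Rgr l a.
Proof.
move=> Rc.
apply: (@dproj_unique _ _ _ (ring_sum Rgr) (dsupp (ring_sum Rgr) a)
  (fun t => c * rproj Rgr t a)).
have [us Rd a0 aE] := dproj_decomposition (ring_sum Rgr) a.
split=> // [t|t ts|]; first exact: (@RgM _ _ Rgr 0%N).
  by rewrite /rproj a0 // mulr0.
by rewrite {1}aE mulr_sumr.
Qed.

Lemma rprojB l : {morph rproj Rgr l : x y / x - y}.
Proof. exact: dprojB. Qed.

Lemma rproj0 l : rproj Rgr l 0 = 0.
Proof. by have := rprojB l 0 0; rewrite !subrr. Qed.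

Lemma rprojD l : {morph rproj Rgr l : x y / x + y}.
Proof.
move=> x y; have -> : x + y = x - (0 - y) by rewrite sub0r opprK.
by rewrite !rprojB rproj0 sub0r opprK.
Qed.

Lemma rproj_sum l (T : Type) (r : seq T) F :
  rproj Rgr l (\sum_(i <- r) F i) = \sum_(i <- r) rproj Rgr l (F i).
Proof. exact: (big_morph _ (rprojD l) (rproj0 l)). Qed.

Lemma m0R_homog l x : m0R x -> m0R (rproj Rgr l x).
Proof.
case: m0_ideal => m0R0 _ _ _ [p [c [u [cm _ ->]]]].
exists p, c, (fun k => rproj Rgr l (u k)); split=> //.
by rewrite rproj_sum; apply: eq_bigr => k _; rewrite rproj_scale0 //; exact: m0R0.
Qed.

Lemma irrelevant_idealE : irrelevant_ideal Rg = [set x | rproj Rgr 0%N x = 0].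
Proof.
apply/seteqP; split=> x /=.
  move=> [p [f [fR ->]]]; rewrite rproj_sum big1 // => k _.
  by apply: dproj_neq (fR k).
move=> x0; pose p := (\max_(l <- dsupp (ring_sum Rgr) x) l)%N.
exists p, (fun k => rproj Rgr k.+1 x); split=> [k|]; first exact: dproj_mem.
have sub : {subset dsupp (ring_sum Rgr) x <= iota 0 p.+1}.
  move=> l ls; rewrite mem_iota /= add0n ltnS.
  exact: (@leq_bigmax_seq _ _ xpredT id).
have [_ _ _ wE] := finite_decomposition_widen (iota_uniq 0 p.+1) sub
  (dproj_decomposition (ring_sum Rgr) x).
rewrite [LHS]wE -/(index_iota 0 p.+1) big_mkord big_ord_recl /=.
have -> : dproj (ring_sum Rgr) 0%N x = 0 by exact: x0.
by rewrite add0r; apply: eq_bigr => k _.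
Qed.

Lemma rproj0M c x : rproj Rgr 0%N x = 0 -> rproj Rgr 0%N (c * x) = 0.
Proof.
move=> x0; rewrite (dproj_sum (ring_sum Rgr) c) mulr_suml rproj_sum.
rewrite big1 // => l _; rewrite (dproj_sum (ring_sum Rgr) x) mulr_sumr rproj_sum.
rewrite big1 // => k _.
have [k0|k0] := eqVneq k 0%N; first by rewrite k0 [X in _ * X]x0 mulr0 rproj0.
apply: (@dproj_neq _ _ _ _ (l + k)%N); first by rewrite eq_sym addn_eq0 negb_and k0 orbT.
by apply: (RgM Rgr); exact: dproj_mem.
Qed.

Lemma b_ideal : ideal_of setT b.
Proof.
have idE := ideal_ext_ideal b0.
split=> // [|_ _ [x [y [Ex Iy ->]]] [x' [y' [Ex' Iy' ->]]]|c _ _ [x [y [Ex Iy ->]]]].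
- exists 0, 0; split; [exact: ideal0| |by rewrite addr0].
  by rewrite irrelevant_idealE /= rproj0.
- exists (x + x'), (y + y'); split; [exact: idealD| |by rewrite addrACA].
  move: Iy Iy'; rewrite irrelevant_idealE /= rprojD => -> ->.
  by rewrite addr0.
exists (c * x), (c * y); split; [exact: idealM| |by rewrite mulrDr].
by move: Iy; rewrite irrelevant_idealE; exact: rproj0M.
Qed.

Lemma m0R_ideal : ideal_of setT m0R.
Proof. exact: ideal_ext_ideal. Qed.

Lemma Rg1_b a : Rg 1%N a -> b a.
Proof.
move=> Ra; exists 0, a; split; [exact: (ideal0 (ideal_ext_ideal b0))| |by rewrite add0r].
by rewrite irrelevant_idealE /=; apply: dproj_neq Ra.
Qed.

Lemma b_homog x : b x -> lspan setT ([set h | b h /\ exists l, Rg l h] : set R^o) x.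
Proof.
case: b0_ideal => b0R _ _ _.
move=> [u [v [[p [c [a [cb _ ->]]]] [q [f [fR ->]]] ->]]].
apply: (@lspanD R R^o); apply: (@lspan_sum R R^o) => k.
  rewrite (dproj_sum (ring_sum Rgr) (a k)) scaler_sumr.
  apply: (@lspan_sum R R^o) => l; apply: lspan_mem; split.
    exists (c k *: (dproj (ring_sum Rgr) l (a k) : R^o)), 0; split.
    - by exists 1%N, (fun=> c k), (fun=> dproj (ring_sum Rgr) l (a k)); split; rewrite ?big_ord1.
    - by rewrite irrelevant_idealE /= rproj0.
    - by rewrite addr0.
  exists l; apply: (@RgM _ _ Rgr 0%N); first exact: b0R.
  exact: dproj_mem.
apply: lspan_mem; split; last by exists k.+1.
exists 0, (f k); split; last by rewrite add0r.
  exact: (ideal0 (ideal_ext_ideal b0)).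
by rewrite irrelevant_idealE /=; apply: dproj_neq (fR k).
Qed.

Lemma loc_cohomology_vanishP (M : grmod Rg) (E : gr_inj_resolution M) i n :
  loc_cohomology b m0R E i n = [set 0] <-> coh_vanish b m0R E i n.
Proof.
exact: (loc_cohomology0P Rnoeth b_ideal m0R_ideal b_homog m0R_homog).
Qed.

Definition coh_bounded i (M : grmod Rg) := forall E : gr_inj_resolution M,
  exists n0 : int, forall n, n0 <= n -> coh_vanish b m0R E i n.

Lemma coh_bounded_ext i (M : grmod Rg) (A : set M)
    (h : A `<=` @homog_elements R Rg M) :
  coh_bounded i (gsub Rgr h) -> coh_bounded i (gquot Rgr h) -> coh_bounded i M.
Proof.
move=> Bsub Bquot E.
have [E' _] := resolution_exists Rgr (gsub Rgr h).
have [E'' _] := resolution_exists Rgr (gquot Rgr h).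
have [n1 H1] := Bsub E'; have [n2 H2] := Bquot E''.
exists (Order.max n1 n2) => n; rewrite ge_max => /andP[/H1 v1 /H2 v2].
apply: (coh_vanish_ext Rgr m0R_ideal (gsub_val_homog (hA := h))
  (gquot_pi_homog Rgr h) (@gsub_val_inj _ _ Rgr _ _ h) _ _ v1 v2).
  exact: gquot_pi_surj.
move=> x; split=> [/gquot_pi_eq0/gsub_val_range|]; first by move=> /(_ Rgr h)[y _ <-]; exists y.
by move=> [y yE]; apply/gquot_pi_eq0/(gsub_val_range Rgr h); exists y.
Qed.

Lemma mul_quotient (M : grmod Rg) (x : M) a (h : [set a *: x] `<=` @homog_elements R Rg M) :
  gr_cyclic x -> forall m, gquot_pi Rgr h m = 0 <-> exists y, a *: y = m.
Proof.
move=> [_ gen] m; split=> [/gquot_pi_eq0/lspan1[r ->]|[y <-]].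
  by exists (r *: x); rewrite !scalerA mulrC.
apply/gquot_pi_eq0/lspan1; have [r ->] := gen y.
by exists r; rewrite !scalerA mulrC.
Qed.

Lemma scale_regular_inj (M : grmod Rg) a :
  (forall m : M, a *: m = 0 -> m = 0) -> injective (GRing.scale a : M -> M).
Proof.
move=> areg x y axy; apply/eqP; rewrite -subr_eq0; apply/eqP/areg.
by rewrite scalerBr axy subrr.
Qed.

(** The components of c are sums of products e v with e in m_0 and v homogeneous: e already turns z
    into a boundary, and v moves it to the right degree. *)
Lemma m0R_hcob i (M : grmod Rg) (E : gr_inj_resolution M) n l c z :
  (forall a, m0 a -> forall m : M, a *: m = 0) -> m0R c ->
  hcocycles b m0R E i n z ->
  hcoboundaries b m0R E i (l%:Z + n) (rproj Rgr l c *: z).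
Proof.
case: m0_ideal => m0R0 _ _ _ m0M [p [e [u [em0 _ ->]]]] Zz.
rewrite rproj_sum scaler_suml; elim/big_rec: _ => [|k y _ By].
  exact: (hcob0 b m0R_ideal).
apply: (hcobD m0R_ideal) => //.
rewrite rproj_scale0; last exact: m0R0.
rewrite mulrC -scalerA; apply: (hcob_scale m0R_ideal).
  exact: dproj_mem.
by apply: (annihilator_hcob Rgr) => //; [exact: m0R0|exact: m0M].
Qed.

(* Some power of a in R_1 acts on a torsion cocycle as an element of m0 R, and
   the latter kills the cohomology of M. *)
Lemma Rg1_nilpotent i (M : grmod Rg) (E : gr_inj_resolution M) n a z :
  (forall c, m0 c -> forall m : M, c *: m = 0) -> Rg 1%N a ->
  hcocycles b m0R E i n z ->
  exists k, hcoboundaries b m0R E i (k%:Z + n) (a ^+ k *: z).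
Proof.
move=> m0M Ra Zz; have [[k H] Gz _] := Zz; exists k.
have [|c cm0 cE] := H k (leqnn k) (a ^+ k).
  apply: lspan_mem; exists (fun=> a) => [_|]; first exact: Rg1_b.
  by rewrite prodr_const card_ord.
have := m0R_hcob k m0M cm0 Zz.
have Rk : Rg k (a ^+ k) by have := RgX Rgr k Ra; rewrite mul1n.
have -> : a ^+ k *: z = gproj (k%:Z + n) (c *: z).
  by rewrite -cE /gproj dproj_id //; exact: grc_scale.
by rewrite (gproj_scale Rgr _ _ Gz) addrK.
Qed.

Lemma coh_bounded_cyclic_killed i (M : grmod Rg) (x : M) : gr_cyclic x ->
  (forall a, m0 a -> forall m : M, a *: m = 0) -> coh_bounded i M.
Proof.
have [_ [s [s1 sgen]]] := Rstd.
elim/ltn_ind: i M x => i IHi M x xM; move: M x xM.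
apply: (cyclic_devissage (Rgr := Rgr) Rnoeth (S := [set` s])).
- by move=> a /s1; exists 1%N.
- move=> M x [[n Gx] gen] sx m0M E.
  (* The generators of degree 1 kill x, so the r with r x in R_0 x form a subring that contains R_0
     and these generators. Hence M = R_0 x lives in degree n. *)
  pose A := [set r | exists2 c, Rg 0%N c & r *: x = c *: x].
  have AT : A = setT.
    apply: sgen => [|c Rc|a sa]; last 2 first.
    - by exists c.
    - by exists 0; [exact: (Rg0 Rgr)|rewrite scale0r; exact: sx].
    split=> [|r r' /set_mem[c Rc cE] /set_mem[c' Rc' c'E]|
              r r' /set_mem[c Rc cE] /set_mem[c' Rc' c'E]]; apply/mem_set.
    - by exists 1 => //; exact: (Rg1 Rgr).
    - by exists (c - c'); [exact: (RgB Rgr)|rewrite !scalerBl cE c'E].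
    - exists (c * c'); first exact: (RgM Rgr (i := 0%N) (j := 0%N)).
      by rewrite -!scalerA c'E !scalerA !(mulrC _ c') -!scalerA cE.
  exists (n + 1) => k nk; apply: (coh_vanish_degree Rgr (s := n)).
    move=> l m nl Gm; have [r mE] := gen m.
    have [c Rc rE] : A r by rewrite AT.
    have Gn : grc n m by rewrite mE rE; exact: grc_scale0.
    rewrite -(dproj_id (grc_sum M) Gm); apply: dproj_neq Gn.
    by apply: contraTneq nl => ->; rewrite ltxx.
  by rewrite -lezD1.
- move=> M A h Qsub Qquot m0M; apply: (coh_bounded_ext (h := h)).
    apply: Qsub => a am0 y; apply: spanmod_val_inj.
    by rewrite spanmod_valZ m0M // raddf0.
  apply: Qquot => a am0 q; have [y <-] := gquot_pi_surj (Rgr := Rgr) (hA := h) q.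
  by rewrite -linearZ (m0M a am0 y) linear0.
move=> M x a h xM sa areg _ m0M E.
have Ra : Rg 1%N a by exact: s1.
have aquot : forall c, m0 c -> forall q : gquot Rgr h, c *: q = 0.
  move=> c cm0 q; have [y <-] := gquot_pi_surj (Rgr := Rgr) (hA := h) q.
  by rewrite -linearZ (m0M c cm0 y) linear0.
have [E'' _] := resolution_exists Rgr (gquot Rgr h).
have [n0 van] : exists n0 : int, forall n, n0 <= n ->
    if i is k.+1 then coh_vanish b m0R E'' k n else True.
  case: i IHi => [|k] IHi; first by exists 0.
  exact: (IHi k (leqnn _) _ _ (gquot_cyclic Rgr h xM) aquot E'').
pose E' := gshift_resolution (-1) E.
pose u : {linear gshift (-1) M -> M} := (GRing.scale a : {linear M -> M}).
pose f k : {linear E' k -> E k} := (GRing.scale a : {linear E k -> E k}).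
have shift_homog (N : grmod Rg) n (y : N) :
    @grc _ _ (gshift (-1) N) n y -> grc n (a *: y).
  move=> Gy; have := grc_scale Ra (Gy : grc (n - 1) y).
  by rewrite addrC subrK.
have inj n z : n0 <= n -> hcocycles b m0R E i (n - 1) z ->
    hcoboundaries b m0R E i n (a *: z) -> hcoboundaries b m0R E i (n - 1) z.
  move=> n0n Zz Baz.
  have : hcoboundaries b m0R E' i n z.
    apply: (@coh_inj _ _ Rgr _ _ m0R_ideal _ _ _ u (gquot_pi Rgr h) _ _ _ _ _
      E' E E'' f) => //.
    - by move=> m y; exact: (shift_homog M).
    - exact: gquot_pi_homog.
    - exact: scale_regular_inj.
    - exact: gquot_pi_surj.
    - exact: mul_quotient.
    - split=> [k m y Gy|k y]; first exact: (shift_homog (E k)).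
      by rewrite /f /= linearZ.
    - by move=> m; rewrite /f /u /= linearZ.
    - exact: van.
  (* Boundaries of E' in degree n are those of E in degree n - 1 by conversion, but only once i is a
     constructor. *)
  by case: (i) z {Zz Baz}.
(* From a^k z a boundary, [inj] cancels one factor a at a time, all degrees met being at least
   n0. *)
exists n0 => n n0n z Zz; have [k Bk] := Rg1_nilpotent m0M Ra Zz.
elim: k Bk => [|k IHk Bk]; first by rewrite expr0 scale1r add0r.
apply: IHk; have -> : k%:Z + n = (k.+1%:Z + n) - 1 by lia.
apply: inj.
- by lia.
- have -> : k.+1%:Z + n - 1 = k%:Z + n by lia.
  apply: (hcoc_scale m0R_ideal) => //.
  by have := RgX Rgr k Ra; rewrite mul1n.
by rewrite scalerA -exprS.
Qed.

Lemma cyclic_fin_gen (M : grmod Rg) (x : M) : gr_cyclic x -> fin_gen M.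
Proof.
move=> [_ gen]; exists [:: x]; apply/seteqP; split=> // m _.
have [r ->] := gen m; apply: lspanZ; apply: lspan_mem.
by rewrite /= inE.
Qed.

Section Separated.
Variable i : nat.
Hypothesis sep : forall M : grmod Rg, fin_gen M ->
  forall E : gr_inj_resolution M, exists n0 : int, forall n : int, n0 <= n ->
    \bigcap_k lspan (ideal_pow (Rg 0%N) m0 k) (loc_cohomology b m0R E i n) = [set 0].

Lemma coh_bounded_cyclic (M : grmod Rg) (x : M) : gr_cyclic x -> coh_bounded i M.
Proof.
have m0R0 a : m0 a -> Rg 0%N a by case: m0_ideal => + _ _ _; apply.
move: M x; apply: (cyclic_devissage (Rgr := Rgr) Rnoeth (S := m0)).
- by move=> a am0; exists 0%N; exact: m0R0.
- move=> M x xM mx; apply: (@coh_bounded_cyclic_killed i M x xM) => a am0 m.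
  have [_ gen] := xM; have [r ->] := gen m.
  by rewrite scalerA mulrC -scalerA mx // scaler0.
- by move=> M A h; exact: coh_bounded_ext.
move=> M x a h xM am0 areg Bquot E.
have [E'' _] := resolution_exists Rgr (gquot Rgr h).
have [n1 van] := Bquot E''; have [n2 capE] := sep (cyclic_fin_gen xM) E.
exists (Order.max n1 n2) => n; rewrite ge_max => /andP[n1n n2n].
have div z : hcocycles b m0R E i n z -> exists y, hcocycles b m0R E i n y /\
    hcoboundaries b m0R E i n (z - a *: y).
  apply: (@coh_surj _ _ Rgr _ _ m0R_ideal _ _ _ (GRing.scale a : {linear M -> M})
    (gquot_pi Rgr h) _ _ _ _ _ E E E'' (fun k => GRing.scale a : {linear E k -> E k})).
  - by move=> k m; apply: grc_scale0; exact: m0R0.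
  - exact: gquot_pi_homog.
  - exact: scale_regular_inj.
  - exact: gquot_pi_surj.
  - exact: mul_quotient.
  - split=> [k m y|k y]; first by apply: grc_scale0; exact: m0R0.
    by rewrite /= linearZ.
  - by move=> m; rewrite /= linearZ.
  - exact: van.
(* With 0 replaced by the intersection, it remains to put each class in m_0^k H^i(M)_n for every
   k. *)
apply/loc_cohomology_vanishP; rewrite -(capE n n2n); apply/seteqP; split; last first.
  rewrite capE // => _ ->; exists 0; last exact: raddf0.
  by split; [split; [exact: (torsion0 b m0R_ideal)|exact: linear0]|exact: grc0].
move=> q [z [[Tz dz] Gz] <-] k _.
(* Iterating [div] writes the class of z as a^k times a class of the same degree. *)
have [y [Zy By]] : exists y, hcocycles b m0R E i n y /\
    hcoboundaries b m0R E i n (z - a ^+ k *: y).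
  elim: k => [|k [y [Zy By]]].
    by exists z; rewrite expr0 scale1r subrr; split; [split|exact: (hcob0 b m0R_ideal)].
  have [w [Zw Bw]] := div y Zy; exists w; split=> //.
  have -> : z - a ^+ k.+1 *: w = (z - a ^+ k *: y) + a ^+ k *: (y - a *: w).
    by rewrite scalerBr scalerA -exprSr addrA subrK.
  apply: (hcobD m0R_ideal) => //.
  rewrite -[n]add0r; apply: (hcob_scale m0R_ideal (l := 0%N) _ Bw).
  by have := RgX Rgr k (m0R0 a am0); rewrite mul0n.
exists 1%N, (fun=> a ^+ k), (fun=> quotmod_pi (@coboundaries _ _ b m0R M E i) y).
split=> [_|_|].
- exists 1%N, (fun=> 1), (fun=> a ^+ k); split=> [_|_|]; first exact: (Rg1 Rgr).
    by exists (fun=> a) => //; rewrite prodr_const card_ord.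
  by rewrite big_ord1 [RHS]mul1r.
- by case: Zy => Ty Gy dy; exists y.
rewrite big_ord1 -linearZ; apply/eqP; rewrite -subr_eq0 -linearB; apply/eqP.
apply/quotmod_pi_eq0/lspan_mem; case: (i) z y {Tz dz Gz Zy} By => [|j] z y //=.
by move=> [w [Tw _ <-]]; exists w.
Qed.

Lemma coh_bounded_fin_gen (M : grmod Rg) : fin_gen M -> coh_bounded i M.
Proof.
suff H (k : nat) : forall (N : grmod Rg) (g : seq N), size g = k ->
    (forall y, y \in g -> exists n, grc n y) ->
    (forall m, lspan setT [set` g] m) -> coh_bounded i N.
  move=> [s sM].
  (* The given generators are replaced by their homogeneous components, so that each one spans a
     graded cyclic submodule and can be split off. *)
  pose g := flatten [seq [seq dproj (grc_sum M) n x | n <- dsupp (grc_sum M) x] | x <- s].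
  apply: (H (size g) M g erefl) => [y|m].
    move=> /flattenP[l /mapP[x xs ->] /mapP[n ns ->]].
    by exists n; exact: dproj_mem.
  have : lspan setT [set` s] m by rewrite sM.
  move: m; apply: lspan_ind => [|x y|c x xs].
  - exact: lspan0.
  - exact: lspanD.
  apply: lspanZ; rewrite (dproj_sum (grc_sum M) x) big_seq.
  apply: big_ind => [|y z|n ns].
  - exact: lspan0.
  - exact: lspanD.
  apply: lspan_mem; apply/flattenP.
  exists [seq dproj (grc_sum M) n x | n <- dsupp (grc_sum M) x].
    by apply: (map_f (fun x => [seq dproj (grc_sum M) n x | n <- dsupp (grc_sum M) x])).
  exact: (map_f (fun n => dproj (grc_sum M) n x)).
elim: k => [|k IH] N [|x g] //= gk ghom gspan.
  (* Without generators the module is zero; the top degree 0 is arbitrary, and 1 is the first degree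
     above it. *)
  move=> E; exists 1 => n n1; apply: (coh_vanish_degree Rgr (s := 0)); last first.
    by rewrite -lezD1.
  move=> l m _ _; move: m (gspan m); apply: lspan_ind => [//|y z -> ->|c y].
    by rewrite addr0.
  by rewrite /= inE.
have [n Gx] := ghom x (mem_head _ _); have h := homog_set1 Gx.
apply: (coh_bounded_ext (h := h)).
  by have [y [_ yc]] := gsub1_cyclic Rgr h; exact: coh_bounded_cyclic yc.
apply: (IH _ [seq gquot_pi Rgr h y | y <- g]).
- by rewrite size_map; case: gk.
- move=> _ /mapP[y yg ->]; have [l Gy] := ghom y (mem_behead (s := x :: g) yg).
  by exists l; exact: gquot_pi_homog.
move=> q; have [m <-] := gquot_pi_surj (Rgr := Rgr) (hA := h) q.
move: m (gspan m) {q}; apply: lspan_ind => [|y z Hy Hz|c y].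
- by rewrite linear0; exact: lspan0.
- by rewrite linearD; exact: lspanD.
rewrite /= inE linearZ => /orP[/eqP->|yg]; apply: lspanZ.
  by rewrite (proj2 (gquot_pi_eq0 _ _ _)); [exact: lspan0|exact: lspan_mem].
by apply: lspan_mem; exact: map_f.
Qed.

End Separated.

End HighDegrees.

Unset Implicit Arguments.

Theorem theorem3p2 (R : comNzRingType) (Rg : nat -> set R) (m0 b0 : set R)
    (i : nat)
    (R_noetherian : noetherian R)
    (R_standard : standard_graded Rg)
    (R0_local : local_ring (Rg 0%N) m0)
    (b0_ideal : ideal_of (Rg 0%N) b0) :
  let b := ideal_add (ideal_ext b0) (irrelevant_ideal Rg) in
  let m0R := ideal_ext m0 in
  (forall M : grmod Rg, fin_gen M -> forall E : gr_inj_resolution M,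
     exists n0 : int, forall n : int, n0 <= n ->
       \bigcap_k lspan (ideal_pow (Rg 0%N) m0 k)
                       (loc_cohomology b m0R E i n) = [set 0]) ->
  forall M : grmod Rg, fin_gen M -> forall E : gr_inj_resolution M,
    exists n0 : int, forall n : int, n0 <= n ->
      loc_cohomology b m0R E i n = [set 0].
Proof.
move=> b m0R sep M Mfg E; have [[m0_ideal _ _] _] := R0_local.
have [n0 van] :=
  coh_bounded_fin_gen R_noetherian R_standard m0_ideal b0_ideal sep Mfg E.
exists n0 => n n0n.
by apply/(loc_cohomology_vanishP R_noetherian R_standard m0_ideal b0_ideal)/van.
Qed.
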